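(* Let $G$ be a finite simple connected graph with edge set $E(G)=\{e_1,\dots,e_m\}$, let $I_G\subseteq \mathbb{K}[e_1,\dots,e_m]$ be its toric ideal, and let $w$ be an even closed primitive walk of $G$. Then $B_w$ belongs to the universal Gr\''obner basis of $I_G$ if and only if $w$ is mixed, i.e. no cyclic block of the graph $\mathbf{w}$ is pure.
   Context: $\mathbb{K}$ is a field. To each edge $e=\{v_i,v_j\}$ of $G$ associate the vector $a_e=v_i+v_j$ in the free abelian group on the vertices of $G$; the toric ideal $I_G$ is the ideal generated by all binomials $\mathbf{e}^{u}-\mathbf{e}^{v}$ with $\sum u_k a_{e_k}=\sum v_k a_{e_k}$. A walk is a sequence of edges $(e_{i_1},\dots,e_{i_q})$ with $e_{i_j}=\{v_{i_j},v_{i_{j+1}}\}$; it is closed if $v_{i_{q+1}}=v_{i_1}$ and even if $q$ is even (edges may repeat). For an even closed walk $w=(e_{i_1},\dots,e_{i_{2q}})$ put $E^+(w)=\prod_{k=1}^q e_{i_{2k-1}}$, $E^-(w)=\prod_{k=1}^q e_{i_{2k}}$ and $B_w=E^+(w)-E^-(w)\in I_G$. The walk $w$ (and $B_w$) is primitive if there is no binomial $\mathbf{e}^u-\mathbf{e}^v\in I_G$ other than $B_w$ with $\mathbf{e}^u\mid E^+(w)$ and $\mathbf{e}^v\mid E^-(w)$. For a primitive walk, the sets $\mathbf{w}^+=\{e_{i_j}: j \text{ odd}\}$ and $\mathbf{w}^-=\{e_{i_j}: j\text{ even}\}$ are disjoint. $\mathbf{w}$ denotes the subgraph of $G$ whose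 vertices and edges are those of $w$. A block of a graph is a maximal connected subgraph without a cut vertex; a cyclic block is a block that is a cycle. A cyclic block $B$ of $\mathbf{w}$ is pure if all its edges lie in $\mathbf{w}^+$ or all lie in $\mathbf{w}^-$. The universal Gr\''obner basis of an ideal is the union of all its reduced Gr\''obner bases over all term orders. *)

(* Defs.v *)
From HB Require Import structures.
From mathcomp Require Import all_boot all_order all_algebra.
From mathcomp Require Import mpoly.
Set Implicit Arguments. Unset Strict Implicit. Unset Printing Implicit Defensive.
Import GRing.Theory.
Local Open Scope ring_scope.

Section Graphs.
Variables (V : finType) (m : nat) (ends : 'I_m -> {set V}).

Definition simple_graph : Prop :=
  (forall k, #|ends k| = 2%N) /\ injective ends.

Definition adjF (F : {set 'I_m}) : rel V :=
  fun x y => [exists k in F, ends k == [set x; y]].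

Definition connected_graph : Prop :=
  forall x y : V, connect (adjF setT) x y.

Definition subgraph (VW : {set V}) (FW : {set 'I_m}) (S : {set V}) (F : {set 'I_m}) :=
  [/\ S \subset VW, F \subset FW & forall k, k \in F -> ends k \subset S].

Definition sg_connected (S : {set V}) (F : {set 'I_m}) : Prop :=
  S != set0 /\ forall x y, x \in S -> y \in S -> connect (adjF F) x y.

Definition cut_vertex (S : {set V}) (F : {set 'I_m}) (x : V) : Prop :=
  x \in S /\ exists y z, [/\ y \in S, z \in S, y != x, z != x &
    ~~ connect (adjF [set k in F | x \notin ends k]) y z].

Definition conn_no_cut (S : {set V}) (F : {set 'I_m}) : Prop :=
  sg_connected S F /\ forall x, ~ cut_vertex S F x.

Definition block (VW : {set V}) (FW : {set 'I_m}) (S : {set V}) (F : {set 'I_m}) :=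
  [/\ subgraph VW FW S F, conn_no_cut S F &
    forall S' F', subgraph VW FW S' F' -> S \subset S' -> F \subset F' ->
      conn_no_cut S' F' -> S' = S /\ F' = F].

Definition is_cycle (S : {set V}) (F : {set 'I_m}) : Prop :=
  exists s : seq V, [/\ uniq s, (3 <= size s)%N, S = [set x in s] &
    F = [set k | has (fun p => ends k == [set p.1; p.2]) (zip s (rot 1 s))]].

Definition cyclic_block VW FW S F := block VW FW S F /\ is_cycle S F.

Definition is_walk (es : seq 'I_m) (vs : seq V) : Prop :=
  (0 < size es)%N /\ size vs = (size es).+1 /\
  all2 (fun e p => ends e == [set p.1; p.2]) es (zip vs (behead vs)).

Definition closed_vs (vs : seq V) : Prop :=
  exists x r, vs = x :: r /\ last x r = x.

Definition even_closed_walk (es : seq 'I_m) (vs : seq V) : Prop :=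
  [/\ is_walk es vs, closed_vs vs & ~~ odd (size es)].

(* edges in odd positions (1-indexed) / even positions (1-indexed) *)
Definition plus_edges (es : seq 'I_m) : seq 'I_m :=
  [seq p.2 | p <- zip (iota 0 (size es)) es & ~~ odd p.1].
Definition minus_edges (es : seq 'I_m) : seq 'I_m :=
  [seq p.2 | p <- zip (iota 0 (size es)) es & odd p.1].

Definition Eplus (es : seq 'I_m) : 'X_{1..m} :=
  [multinom count_mem i (plus_edges es) | i < m].
Definition Eminus (es : seq 'I_m) : 'X_{1..m} :=
  [multinom count_mem i (minus_edges es) | i < m].

Definition wplus (es : seq 'I_m) : {set 'I_m} := [set e in plus_edges es].
Definition wminus (es : seq 'I_m) : {set 'I_m} := [set e in minus_edges es].

Definition wedges (es : seq 'I_m) : {set 'I_m} := [set e in es].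
Definition wverts (es : seq 'I_m) : {set V} := \bigcup_(e in wedges es) ends e.

Definition pure_block (es : seq 'I_m) (F : {set 'I_m}) : Prop :=
  F \subset wplus es \/ F \subset wminus es.

Definition mixed (es : seq 'I_m) : Prop :=
  forall S F, cyclic_block (wverts es) (wedges es) S F -> ~ pure_block es F.

Definition mdivides (u v : 'X_{1..m}) : Prop := forall i, (u i <= v i)%N.

Section Poly.
Variable K : fieldType.

Definition in_ideal_gen (S : {mpoly K[m]} -> Prop) (p : {mpoly K[m]}) : Prop :=
  exists n (c g : 'I_n -> {mpoly K[m]}),
    (forall i, S (g i)) /\ p = \sum_(i < n) c i * g i.

(* sum_k u_k a_{e_k}, evaluated at vertex x *)
Definition Amap (u : 'X_{1..m}) (x : V) : nat :=
  \sum_(k < m | x \in ends k) u k.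

Definition toric_binomial (p : {mpoly K[m]}) : Prop :=
  exists u v : 'X_{1..m}, (forall x, Amap u x = Amap v x) /\ p = 'X_[u] - 'X_[v].

Definition toric_ideal (p : {mpoly K[m]}) : Prop := in_ideal_gen toric_binomial p.

Definition Bw (es : seq 'I_m) : {mpoly K[m]} := 'X_[Eplus es] - 'X_[Eminus es].

Definition primitive (es : seq 'I_m) : Prop :=
  Eplus es != Eminus es /\
  forall u v : 'X_{1..m}, u != v -> toric_ideal ('X_[u] - 'X_[v]) ->
    mdivides u (Eplus es) -> mdivides v (Eminus es) ->
    'X_[u] - 'X_[v] = Bw es.

Definition term_order (lt : rel 'X_{1..m}) : Prop :=
  [/\ irreflexive lt, transitive lt,
      (forall u v, u != v -> lt u v || lt v u),
      (forall u v w, lt u v -> lt (u + w)%MM (v + w)%MM) &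
      (forall u, u != 0%MM -> lt 0%MM u)].

Definition is_lead (lt : rel 'X_{1..m}) (p : {mpoly K[m]}) (u : 'X_{1..m}) : Prop :=
  u \in msupp p /\ forall u', u' \in msupp p -> u' != u -> lt u' u.

Definition reduced_groebner (I : {mpoly K[m]} -> Prop) (lt : rel 'X_{1..m})
    (G : seq {mpoly K[m]}) : Prop :=
  [/\ forall g, g \in G -> I g,
      (forall f u, I f -> is_lead lt f u ->
         exists2 g, g \in G & exists ug, is_lead lt g ug /\ mdivides ug u),
      (forall g, g \in G -> exists ug, is_lead lt g ug /\ g@_ug = 1) &
      (forall g g', g \in G -> g' \in G -> g != g' ->
         forall ug', is_lead lt g' ug' ->
         forall u, u \in msupp g -> ~ mdivides ug' u)].

Definition in_universal_GB (I : {mpoly K[m]} -> Prop) (p : {mpoly K[m]}) : Prop :=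
  exists lt G, [/\ term_order lt, reduced_groebner I lt G & (p \in G \/ - p \in G)].

End Poly.
End Graphs.

(* Main.v *)
Require Import Defs.
From HB Require Import structures.
From mathcomp Require Import all_boot all_order all_algebra.
From mathcomp Require Import mpoly.
From mathcomp Require Import zify ring.
From Stdlib Require Import Classical.

(** Write P and M for the exponents of E^+(w) and E^-(w), and b for their common vertex
degree vector. Cutting w at repeated vertices gives everything needed of its structure:
b <= 2, and where b(x) = 2 the vertex x separates the P-edges at x from the M-edges at x.

If the walk has a cycle x_1 ... x_s of P-edges e_i, let m_i and n_i be the parts of P and M
hanging at x_i, so that n_i and m_i x_i^2 have the same vertex degrees. If B_w lies in a
reduced Groebner basis, then all proper divisors of e^P and e^M are standard. The divisors
n_i n_(i+1) of e^M give n_i n_(i+1) < e_i^2 m_i m_(i+1), and multiplying over i,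
prod n_i < prod e_i m_i. For s odd the divisors m_i e_i e_(i+2) ... of e^P give the
opposite inequality; for s even, e_1 e_3 ... and e_2 e_4 ... are two standard monomials
with the same vertex degrees.

Conversely, an element u of the fiber of P supported on w has at each vertex either no
P-edge or no M-edge. If no cycle is pure, then every connected component of the graph of
P-edges has a vertex x lying on exactly one of these edges, and u is determined on that
component as soon as it is positive at x. This yields a linear weight that vanishes at P
and M and is positive on the rest of the fiber; ordering by this weight makes one of P, M
the minimum of the fiber and the other one a minimal nonstandard monomial. *)

Set Implicit Arguments. Unset Strict Implicit. Unset Printing Implicit Defensive.
Import GRing.Theory Num.Theory Order.TTheory.

(** * Vertex degrees of monomials *)

Section Amap.
Variables (V : finType) (m : nat) (ends : 'I_m -> {set V}).
Implicit Types u v : 'X_{1..m}.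

Lemma Amap0 x : Amap ends 0%MM x = 0.
Proof. by rewrite /Amap big1 // => k _; rewrite mnm0E. Qed.

Lemma AmapD u v x : Amap ends (u + v)%MM x = Amap ends u x + Amap ends v x.
Proof. by rewrite /Amap -big_split; apply: eq_bigr => k _; rewrite mnmDE. Qed.

Lemma AmapU k x : Amap ends U_(k)%MM x = (x \in ends k).
Proof.
rewrite /Amap (bigID (pred1 k)) /= [X in _ + X]big1 => [|i /andP[_ ik]]; last first.
  by rewrite mnm1E eq_sym (negPf ik).
rewrite addn0; case: (boolP (x \in ends k)) => xk.
  rewrite (big_pred1 k) ?mnm1E ?eqxx // => i /=.
  by case: eqP => [->|]; rewrite ?xk ?andbT ?andbF.
by rewrite big1 // => i /andP[xi /eqP ik]; rewrite ik (negPf xk) in xi.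
Qed.

Lemma Amap_sum (I : Type) (r : seq I) (P : pred I) (F : I -> 'X_{1..m}) x :
  Amap ends (\sum_(i <- r | P i) F i)%MM x = \sum_(i <- r | P i) Amap ends (F i) x.
Proof.
by rewrite (big_morph _ (fun u v => AmapD u v x) (Amap0 x)).
Qed.

Lemma AmapB u v x : (v <= u)%MM -> Amap ends (u - v)%MM x = Amap ends u x - Amap ends v x.
Proof. by move=> vu; rewrite -{2}(submK vu) AmapD addnK. Qed.

Lemma Amap_le u v x : (u <= v)%MM -> Amap ends u x <= Amap ends v x.
Proof. by move=> uv; rewrite -(submK uv) AmapD leq_addl. Qed.

Lemma Amap_ge u k x : x \in ends k -> u k <= Amap ends u x.
Proof. by move=> xk; rewrite /Amap (bigD1 k) //= leq_addr. Qed.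

Lemma sum_Amap u : (forall k, #|ends k| = 2) -> \sum_x Amap ends u x = (mdeg u).*2.
Proof.
move=> H2; rewrite /Amap (exchange_big_dep xpredT) //= mdegE -mul2n big_distrr /=.
by apply: eq_bigr => k _; rewrite sum_nat_const H2.
Qed.

Lemma eq_Amap_mdeg u v : (forall k, #|ends k| = 2) ->
  Amap ends u =1 Amap ends v -> mdeg u = mdeg v.
Proof.
move=> H2 uv; apply: double_inj.
by rewrite -!sum_Amap //; apply: eq_bigr => x _; rewrite uv.
Qed.

End Amap.

Lemma mdeg_le m (u v : 'X_{1..m}) : (u <= v)%MM -> mdeg u <= mdeg v.
Proof. by move=> uv; rewrite -(submK uv) mdegD leq_addl. Qed.

Lemma mnm_le_mdeg m (u v : 'X_{1..m}) : (u <= v)%MM -> mdeg u = mdeg v -> u = v.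
Proof.
move=> uv duv; rewrite -(submK uv); suff -> : (v - u)%MM = 0%MM by rewrite add0m.
by apply/eqP; rewrite -mdeg_eq0; move: duv; rewrite -{1}(submK uv) mdegD; lia.
Qed.

(** * Monomial orders *)

Definition monomial_order m (lt : rel 'X_{1..m}) : Prop :=
  [/\ irreflexive lt, transitive lt,
      forall u v, u != v -> lt u v || lt v u &
      forall u v w, lt u v -> lt (u + w)%MM (v + w)%MM].

Definition refine_by m (f : 'X_{1..m} -> int) (lt : rel 'X_{1..m}) : rel 'X_{1..m} :=
  fun u v => (f u < f v)%R || ((f u == f v) && lt u v).

Section MonomialOrder.
Variables (m : nat).
Implicit Types (lt : rel 'X_{1..m}) (u v w : 'X_{1..m}).

Lemma refine_by_order (f : 'X_{1..m} -> int) lt :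
    {morph f : u v / (u + v)%MM >-> (u + v)%R} ->
  monomial_order lt -> monomial_order (refine_by f lt).
Proof.
move=> fD [irr tr tot add]; rewrite /refine_by; split.
- by move=> u; rewrite ltxx irr andbF.
- move=> v u w /orP[uv|/andP[/eqP uv luv]] /orP[vw|/andP[/eqP vw lvw]].
  + by rewrite (lt_trans uv vw).
  + by rewrite -vw uv.
  + by rewrite uv vw.
  + by rewrite uv vw eqxx (tr _ _ _ luv lvw) orbT.
- by move=> u v uv; case: ltgtP => //= _; apply: tot.
- move=> u v w; rewrite !fD ltrD2r (inj_eq (addIr (f w))).
  by case/orP => [->//|/andP[->/= /add ->]]; rewrite orbT.
Qed.

Lemma mnmc_order : monomial_order (fun u v => (u < v)%O).
Proof.
split.
- by move=> u; rewrite ltxx.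
- by move=> v u w; apply: lt_trans.
- by move=> u v; case: ltgtP.
- by move=> u v w; rewrite ltmc_add2l.
Qed.

Definition mdegz u : int := Posz (mdeg u).

Lemma mdegzD : {morph mdegz : u v / (u + v)%MM >-> (u + v)%R}.
Proof. by move=> u v; rewrite /mdegz mdegD. Qed.

Lemma refine_mdeg_term_order lt : monomial_order lt -> term_order (refine_by mdegz lt).
Proof.
move=> /(refine_by_order mdegzD) [irr tr tot add]; split=> // u u0.
have du : 0 < mdeg u by rewrite lt0n mdeg_eq0.
by rewrite /refine_by /mdegz mdeg0 ltz_nat du.
Qed.

Lemma term_order_monomial lt : term_order lt -> monomial_order lt.
Proof. by case. Qed.

Section Theory.
Variable lt : rel 'X_{1..m}.
Hypothesis Hlt : monomial_order lt.

Lemma mlt_irr u : lt u u = false. Proof. by case: Hlt. Qed.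
Lemma mlt_trans v u w : lt u v -> lt v w -> lt u w.
Proof. by case: Hlt => _ tr _ _; apply: tr. Qed.
Lemma mlt_total u v : u != v -> lt u v || lt v u.
Proof. by case: Hlt => _ _ tot _; apply: tot. Qed.
Lemma mlt_asym u v : lt u v -> lt v u = false.
Proof. by move=> uv; apply/negP => /(mlt_trans uv); rewrite mlt_irr. Qed.
Lemma mlt_add2r u v w : lt (u + w)%MM (v + w)%MM = lt u v.
Proof.
have add a b c : lt a b -> lt (a + c)%MM (b + c)%MM by case: Hlt => _ _ _; apply.
apply/idP/idP => [luv|/add //]; have [uv|/mlt_total/orP[//|/(@add _ _ w)]] := eqVneq u v.
  by rewrite uv mlt_irr in luv.
by rewrite (mlt_asym luv).
Qed.
Lemma mlt_add u v u' v' : lt u v -> lt u' v' -> lt (u + u')%MM (v + v')%MM.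
Proof.
move=> uv uv'; apply: (@mlt_trans (v + u')%MM); first by rewrite mlt_add2r.
by rewrite ![(v + _)%MM]addmC mlt_add2r.
Qed.

Lemma mlt_sum n (f g : nat -> 'X_{1..m}) :
  (forall i, i < n.+1 -> lt (f i) (g i)) ->
  lt (\sum_(i < n.+1) f i)%MM (\sum_(i < n.+1) g i)%MM.
Proof.
elim: n => [|n IH] H; first by rewrite !big_ord1 H.
rewrite big_ord_recr [X in lt _ X]big_ord_recr /=.
by apply: mlt_add; [apply: IH => i ? | ]; apply: H; lia.
Qed.

Lemma mlt_double u v : lt (u + u)%MM (v + v)%MM -> lt u v.
Proof.
move=> luv; have [uv|/mlt_total/orP[//|vu]] := eqVneq u v.
  by rewrite uv mlt_irr in luv.
by move: (mlt_add vu vu) luv => /mlt_asym ->.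
Qed.

End Theory.
End MonomialOrder.

(** * Dickson's lemma *)

Lemma dickson_coords m (J : seq 'I_m) (S : 'X_{1..m} -> Prop) :
  exists T : seq 'X_{1..m}, (forall t, t \in T -> S t) /\
    forall u, S u -> exists2 t, t \in T & forall j, j \in J -> t j <= u j.
Proof.
elim: J S => [|j J IH] S.
  have [[u0 Su0]|nS] := classic (exists u, S u).
    by exists [:: u0]; split=> [t|u _]; [rewrite inE => /eqP-> | exists u0; rewrite ?mem_head].
  by exists [::]; split=> // u Su; case: nS; exists u.
have [T' [T'S T'J]] := IH S.
have [N HN] : exists N, forall t : 'X_{1..m}, t \in T' -> t j <= N.
  exists (\max_(t <- T') (t : 'X_{1..m}) j) => t tT.
  by rewrite (big_rem t) //= leq_maxl.
have [T [TS TJ]] : exists T : seq 'X_{1..m}, (forall t, t \in T -> S t) /\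
    forall u, S u -> u j < N -> exists2 t : 'X_{1..m}, t \in T & t j = u j /\ forall i, i \in J -> t i <= u i.
  elim: N {HN} => [|N [T [TS TJ]]]; first by exists [::].
  have [T1 [T1S T1J]] := IH (fun u => S u /\ u j = N).
  exists (T1 ++ T); split=> [t|u Su].
    by rewrite mem_cat => /orP[/T1S[]|/TS].
  rewrite ltnS leq_eqVlt => /orP[/eqP uN|uN].
    have [t tT1 Ht] := T1J u (conj Su uN); exists t; first by rewrite mem_cat tT1.
    by rewrite uN; case: (T1S _ tT1).
  by have [t tT Ht] := TJ u Su uN; exists t; rewrite // mem_cat tT orbT.
exists (T' ++ T); split=> [t|u Su].
  by rewrite mem_cat => /orP[/T'S|/TS].
have [uN|Nu] := ltnP (u j) N.
  have [t tT [tj tJ]] := TJ u Su uN; exists t; first by rewrite mem_cat tT orbT.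
  by move=> i; rewrite inE => /orP[/eqP->|/tJ//]; rewrite tj.
have [t tT' tJ] := T'J u Su; exists t; first by rewrite mem_cat tT'.
by move=> i; rewrite inE => /orP[/eqP->|/tJ//]; apply: leq_trans (HN _ tT') Nu.
Qed.

Lemma dickson m (S : 'X_{1..m} -> Prop) :
  exists T : seq 'X_{1..m}, (forall t, t \in T -> S t) /\
    forall u, S u -> exists2 t, t \in T & (t <= u)%MM.
Proof.
have [T [TS TJ]] := dickson_coords (enum 'I_m) S; exists T; split=> // u /TJ[t tT Ht].
by exists t => //; apply/mnm_lepP => j; apply: Ht; rewrite mem_enum.
Qed.

(** * Standard monomials and reduced Gröbner bases of toric ideals of graphs *)

Section Groebner.
Variables (K : fieldType) (V : finType) (m : nat) (ends : 'I_m -> {set V}).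
Hypothesis Hcard : forall k, #|ends k| = 2.
Implicit Types a b c d u v : 'X_{1..m}.
Local Notation toric := (@toric_ideal V m ends K).

Lemma toric_ideal_binomial u v :
  Amap ends u =1 Amap ends v -> toric ('X_[u] - 'X_[v])%R.
Proof.
move=> uv; exists 1, (fun=> 1%R), (fun=> ('X_[u] - 'X_[v])%R).
by split=> [_|]; [exists u, v | rewrite big_ord1 mul1r].
Qed.

Definition vertex_mnm u : 'X_{1..#|V|} := [multinom Amap ends u (enum_val i) | i < #|V|].

Lemma vertex_mnmP u v : reflect (Amap ends u =1 Amap ends v) (vertex_mnm u == vertex_mnm v).
Proof.
apply: (iffP eqP) => [/mnmP uv x|uv]; last by apply/mnmP => i; rewrite !mnmE uv.
by move: (uv (enum_rank x)); rewrite !mnmE enum_rankK.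
Qed.

(* The toric ideal lies in the kernel of the map sending the edge xy to the product x * y. *)
Local Notation toric_map :=
  (mmap (@mpolyC #|V| K) (fun k => 'X_[vertex_mnm U_(k)] : {mpoly K[#|V|]})%R).

Lemma toric_mapX u : toric_map 'X_[u] = ('X_[vertex_mnm u])%R.
Proof.
rewrite mmapX /mmap1; under eq_bigr do rewrite mpolyXn.
rewrite mprodXE; congr ('X_[_])%R; apply/mnmP => i; rewrite mnm_sumE mnmE.
rewrite (eq_bigr (fun k => (enum_val i \in ends k) * u k)) => [|k _]; last first.
  by rewrite mulmnE mnmE AmapU.
by rewrite /Amap [RHS]big_mkcond; apply: eq_bigr => k _; case: (_ \in _); rewrite ?mul1n.
Qed.

Lemma toric_map_ideal f : toric f -> toric_map f = 0%R.
Proof.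
move=> [n [c [g [Hg ->]]]]; rewrite rmorph_sum big1 // => i _.
rewrite rmorphM /=; have [u [v [/vertex_mnmP/eqP uv ->]]] := Hg i.
by rewrite rmorphB /= !toric_mapX uv subrr mulr0.
Qed.

Lemma toric_ideal_fiber f u : toric f -> u \in msupp f ->
  exists v, [/\ v \in msupp f, v != u & Amap ends v =1 Amap ends u].
Proof.
move=> /toric_map_ideal f0 uf; apply: NNPP => H.
have /(congr1 (mcoeff (vertex_mnm u))) := f0.
rewrite [X in mmap _ _ X](mpolyE f) (raddf_sum (mmap _ _)) raddf_sum mcoeff0.
rewrite (bigD1_seq u) ?msupp_uniq //= big1_seq => [|v /andP[vu vf]].
  rewrite -mul_mpolyC rmorphM /= mmapC toric_mapX.
  rewrite mcoeffCM mcoeffX eqxx mulr1 addr0 => /eqP.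
  by rewrite (negPf (_ : f@_u != 0)%R) // -mcoeff_msupp.
rewrite -mul_mpolyC rmorphM /= mmapC toric_mapX.
rewrite mcoeffCM mcoeffX; case: vertex_mnmP => [vu'|]; last by rewrite mulr0.
by case: H; exists v.
Qed.

Definition same_fiber a b := [forall x, Amap ends a x == Amap ends b x].

Lemma same_fiberP a b : reflect (Amap ends a =1 Amap ends b) (same_fiber a b).
Proof. exact: (iffP 'forall_eqP). Qed.

Variable lt : rel 'X_{1..m}.

Definition standard a : bool :=
  [forall c : 'X_{1..m < (mdeg a).+1}, same_fiber c a ==> ~~ lt c a].

Definition minimal_nonstandard a : bool :=
  ~~ standard a && [forall i, (0 < a i) ==> standard (a - U_(i))%MM].

Lemma standardP a :
  reflect (forall c, Amap ends c =1 Amap ends a -> ~~ lt c a) (standard a).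
Proof.
apply: (iffP forallP) => [H c ca|H c]; last by apply/implyP => /same_fiberP/H.
have dc : mdeg c < (mdeg a).+1 by rewrite (eq_Amap_mdeg Hcard ca).
by have /implyP := H (BMultinom dc); apply; apply/same_fiberP.
Qed.

Lemma nonstandardP a :
  reflect (exists2 c, Amap ends c =1 Amap ends a & lt c a) (~~ standard a).
Proof.
apply: (iffP idP) => [|[c ca lca]]; last by apply/standardP => /(_ c ca)/negP.
move=> /forallPn[c]; rewrite negb_imply negbK => /andP[/same_fiberP ca lca].
by exists c.
Qed.

Hypothesis Hlt : monomial_order lt.

Lemma standard_div d a : (d <= a)%MM -> standard a -> standard d.
Proof.
move=> da /standardP Sa; apply/standardP => c cd; apply: contra (Sa (c + (a - d))%MM _).
  by rewrite -(mlt_add2r Hlt _ _ (a - d)%MM) [(d + _)%MM]addmC submK.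
by move=> x; rewrite AmapD cd -AmapD addmC submK.
Qed.

Lemma fiber_min a : exists b, standard b && same_fiber b a.
Proof.
suff [b ba Hb] : exists2 b, Amap ends b =1 Amap ends a &
    forall c, c \in [seq bmnm c | c : 'X_{1..m < (mdeg a).+1}] -> same_fiber c a -> ~~ lt c b.
  exists b; rewrite (introT (same_fiberP _ _) ba) andbT; apply/standardP => c cb.
  have ca x : Amap ends c x = Amap ends a x by rewrite cb ba.
  have dc : mdeg c < (mdeg a).+1 by rewrite (eq_Amap_mdeg Hcard ca).
  by apply: Hb; [apply/mapP; exists (BMultinom dc); rewrite ?mem_enum | apply/same_fiberP].
elim: [seq _ | _ : _] => [|c s [b ba Hb]]; first by exists a.
have [/andP[/same_fiberP ca cb]|nc] := boolP (same_fiber c a && lt c b).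
  exists c => // d; rewrite inE => /orP[/eqP-> _|ds da]; first by rewrite (mlt_irr Hlt).
  by apply: contra (Hb d ds da) => dc; apply: mlt_trans dc cb.
exists b => // d; rewrite inE => /orP[/eqP-> ca|]; last exact: Hb.
by rewrite ca in nc.
Qed.

Definition normal_form a := xchoose (fiber_min a).

Lemma normal_form_standard a : standard (normal_form a).
Proof. by case/andP: (xchooseP (fiber_min a)). Qed.

Lemma normal_form_fiber a : Amap ends (normal_form a) =1 Amap ends a.
Proof. by case/andP: (xchooseP (fiber_min a)) => _ /same_fiberP. Qed.

Lemma standard_uniq a b : standard a -> standard b -> Amap ends a =1 Amap ends b -> a = b.
Proof.
move=> /standardP Sa /standardP Sb ab; apply/eqP/idPn => /(mlt_total Hlt) /orP[].
  by apply/negP/Sb.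
by apply/negP/Sa => x; rewrite ab.
Qed.

Lemma normal_form_lt a : ~~ standard a -> lt (normal_form a) a.
Proof.
move=> nSa; have : normal_form a != a.
  by apply: contraNneq nSa => <-; apply: normal_form_standard.
case/(mlt_total Hlt)/orP => // /negP; case; apply/negP.
by apply: (standardP _ (normal_form_standard a)) => x; rewrite normal_form_fiber.
Qed.

Lemma nonstandard_minimal u : ~~ standard u ->
  exists2 a, minimal_nonstandard a & (a <= u)%MM.
Proof.
have [n le_n] := ubnP (mdeg u); elim: n u le_n => // n IH u le_n nSu.
have [/forallP H|/forallPn[i]] := boolP [forall i, (0 < u i) ==> standard (u - U_(i))%MM].
  by exists u; rewrite ?lepm_refl // /minimal_nonstandard nSu; apply/forallP.
rewrite negb_imply => /andP[ui nS].
have iu : (U_(i) <= u)%MM.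
  by apply/mnm_lepP => j; rewrite mnm1E; case: eqP => // <-.
have [|a Ha au] := IH _ _ nS.
  by move: le_n; rewrite -{1}(submK iu) mdegD mdeg1 addn1.
by exists a => //; apply: lepm_trans au (lem_subr _ _).
Qed.

Lemma minimal_nonstandard_div a t :
  minimal_nonstandard a -> ~~ standard t -> (t <= a)%MM -> t = a.
Proof.
move=> /andP[_ /forallP Ha] nSt ta; apply/eqP; apply: contraNT nSt => t_a.
have [i ti] : exists i, t i < a i.
  apply: NNPP => H; case/eqP: t_a; apply/mnmP => i; apply/eqP.
  by rewrite eqn_leq (mnm_lepP ta) leqNgt; apply/negP => ?; case: H; exists i.
apply: standard_div (implyP (Ha i) _); last by apply: leq_trans ti.
apply/mnm_lepP => j; rewrite mnmBE mnm1E; case: eqP => [<-|_]; first by lia.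
by rewrite subn0 (mnm_lepP ta).
Qed.

Definition gb_elt a : {mpoly K[m]} := ('X_[a] - 'X_[normal_form a])%R.

Lemma msupp_binomial u v w : w \in msupp ('X_[u] - 'X_[v] : {mpoly K[m]})%R ->
  w = u \/ w = v.
Proof.
move/msuppB_le; rewrite !msuppX mem_cat !inE.
by case/orP => /eqP ->; [left|right].
Qed.

Lemma msupp_binomialE u v : u != v ->
  msupp ('X_[u] - 'X_[v] : {mpoly K[m]})%R =i [:: u; v].
Proof.
move=> uv w; rewrite mcoeff_msupp mcoeffB !mcoeffX !inE ![_ == w]eq_sym.
case: (eqVneq w u) => [->|wu]; first by rewrite (negPf uv) subr0 oner_eq0.
by case: (w == v); rewrite ?subrr ?eqxx // sub0r oppr_eq0 oner_eq0.
Qed.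

Lemma is_lead_uniq (f : {mpoly K[m]}) u v : is_lead lt f u -> is_lead lt f v -> u = v.
Proof.
move=> [uf Hu] [vf Hv]; apply/eqP; apply: contraTT isT => uv.
have luv : lt u v by apply: Hv.
have : lt v u by apply: Hu; rewrite // eq_sym.
by rewrite (mlt_asym Hlt luv).
Qed.

Lemma is_lead_binomial u v : lt v u -> is_lead lt ('X_[u] - 'X_[v] : {mpoly K[m]})%R u.
Proof.
move=> lvu; have uv : u != v by apply: contraTneq lvu => ->; rewrite (mlt_irr Hlt).
split=> [|w]; rewrite msupp_binomialE ?inE ?eqxx //.
by case/orP=> /eqP -> //; rewrite eqxx.
Qed.

Lemma mdividesP u v : mdivides u v <-> (u <= v)%MM.
Proof. by split=> /mnm_lepP. Qed.

Lemma toric_reduced_groebner : exists2 G, reduced_groebner toric lt G &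
  forall a, minimal_nonstandard a -> gb_elt a \in G.
Proof.
have [T [TS TH]] := dickson (fun a => ~~ standard a).
have minT a : minimal_nonstandard a -> a \in T.
  move=> Ha; have /TH[t tT ta] : ~~ standard a by case/andP: Ha.
  by rewrite -(minimal_nonstandard_div Ha (TS _ tT) ta).
have leadE a : minimal_nonstandard a -> is_lead lt (gb_elt a) a.
  by case/andP => nSa _; apply: is_lead_binomial; apply: normal_form_lt.
exists [seq gb_elt a | a <- T & minimal_nonstandard a]; last first.
  by move=> a Ha; apply/mapP; exists a; rewrite // mem_filter Ha minT.
split.
- move=> g /mapP[a _ ->]; apply: toric_ideal_binomial => x.
  by rewrite normal_form_fiber.
- move=> f u If [uf Hu]; have [v [vf vu Avu]] := toric_ideal_fiber If uf.
  have /nonstandard_minimal[a Ha au] : ~~ standard u.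
    by apply/nonstandardP; exists v => //; apply: Hu.
  exists (gb_elt a); first by apply/mapP; exists a; rewrite // mem_filter Ha minT.
  by exists a; split; [apply: leadE | apply/mdividesP].
- move=> g /mapP[a]; rewrite mem_filter => /andP[Ha _] ->; exists a; split; first exact: leadE.
  rewrite mcoeffB !mcoeffX eqxx (negPf (_ : normal_form a != a)) ?subr0 //.
  by case/andP: Ha => /normal_form_lt + _; apply: contraTneq => ->; rewrite (mlt_irr Hlt).
move=> g g' /mapP[a + ->] /mapP[b + ->]; rewrite !mem_filter => /andP[Ha _] /andP[Hb _] ab u' Hu' u.
have {u' Hu'} -> := is_lead_uniq Hu' (leadE _ Hb).
have nSb : ~~ standard b by case/andP: Hb.
case/msupp_binomial => -> /mdividesP.
  by move=> /(minimal_nonstandard_div Ha nSb) ba; rewrite ba eqxx in ab.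
by move/standard_div/(_ (normal_form_standard a)); apply/negP.
Qed.

Lemma binomial_mem_groebner a b :
    minimal_nonstandard a -> standard b -> Amap ends a =1 Amap ends b ->
  exists2 G, reduced_groebner toric lt G & ('X_[a] - 'X_[b])%R \in G.
Proof.
move=> Ha Sb ab; have [G redG HG] := toric_reduced_groebner; exists G => //.
suff -> : b = normal_form a by apply: HG.
by apply: standard_uniq => //; [apply: normal_form_standard | move=> x; rewrite normal_form_fiber].
Qed.

Lemma groebner_proper_divisor_standard G (f : {mpoly K[m]}) a b d :
    reduced_groebner toric lt G -> f \in G -> a != b -> msupp f =i [:: a; b] ->
    Amap ends a =1 Amap ends b -> (d <= a)%MM -> d != a ->
  standard d.
Proof.
move=> [_ HG Hlc Hred] fG neab suppf ab da d_a; apply: NNPP => /negP/nonstandardP[c cd lcd].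
have dc x : Amap ends d x = Amap ends c x by rewrite cd.
have [g gG [u [gu /mdividesP ud]]] := HG _ _ (toric_ideal_binomial dc) (is_lead_binomial lcd).
have ua : (u <= a)%MM := lepm_trans ud da.
have fg : f != g.
  apply: contraNneq d_a => fg; move: gu; rewrite -fg => -[+ _].
  rewrite suppf !inE => /orP[]/eqP u_eq.
    rewrite u_eq in ud; apply/eqP/(mnm_le_mdeg da)/eqP.
    by rewrite eqn_leq !mdeg_le.
  by case/eqP: neab; rewrite -u_eq; apply/esym/(mnm_le_mdeg ua)/(eq_Amap_mdeg Hcard) => x; rewrite u_eq ab.
by case: (Hred f g fG gG fg u gu a) => //; [rewrite suppf mem_head | apply/mdividesP].
Qed.
End Groebner.

(** * Primitive walks as minimal balanced pairs of monomials *)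

Section PrimitivePair.
Variables (V : finType) (m : nat) (ends : 'I_m -> {set V}).
Implicit Types P M : 'X_{1..m}.

Definition separates P M (x : V) (L : {set 'I_m}) : Prop :=
  [/\ forall e, x \in ends e -> 0 < P e -> e \in L,
      forall e, x \in ends e -> 0 < M e -> e \notin L &
      forall e f y, 0 < P e + M e -> 0 < P f + M f -> e \in L -> f \notin L ->
        y \in ends e -> y \in ends f -> y = x].

Record primitive_pair P M : Prop := PrimitivePair {
  pp_balanced : Amap ends P =1 Amap ends M;
  pp_minimal : forall u v : 'X_{1..m}, (u <= P)%MM -> (v <= M)%MM ->
    Amap ends u =1 Amap ends v -> u = v \/ (u = P /\ v = M);
  pp_disjoint : forall e, 0 < P e -> M e = 0;
  pp_neq : P != M;
  pp_le2 : forall x, Amap ends P x <= 2;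
  pp_separation : forall x, Amap ends P x = 2 -> exists L, separates P M x L }.

Lemma primitive_pair_sym P M : primitive_pair P M -> primitive_pair M P.
Proof.
case=> bal min dis neq le2 sep; split.
- by move=> x; rewrite bal.
- move=> u v uM vP uv; case: (min v u vP uM) => [x|->|[-> ->]]; [by rewrite uv|by left|by right].
- by move=> e Me; apply: contraTeq Me; rewrite -!lt0n => /dis ->.
- by rewrite eq_sym.
- by move=> x; rewrite -bal.
- move=> x; rewrite -bal => /sep[L [PL ML LL]]; exists (~: L); split.
  + by move=> e xe Me; rewrite inE ML.
  + by move=> e xe Pe; rewrite inE negbK PL.
  + move=> e f y; rewrite !inE negbK addnC [M f + _]addnC => We Wf eL fL ye yf.
    exact: (LL f e).
Qed.

End PrimitivePair.

Section Walk.
Variables (V : finType) (m : nat) (ends : 'I_m -> {set V}).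
Hypothesis Hcard : forall k, #|ends k| = 2.
Variables (n : nat) (e : nat -> 'I_m) (v : nat -> V).
Hypothesis Hends : forall k, k < n -> ends (e k) = [set v k; v k.+1].

Definition walk_mnm (Q : pred nat) : 'X_{1..m} := (\sum_(k < n | Q k) U_(e k))%MM.

Lemma walk_mnmE Q i : walk_mnm Q i = \sum_(k < n | Q k) (e k == i).
Proof. by rewrite mnm_sumE; apply: eq_bigr => k _; rewrite mnm1E. Qed.

Lemma walk_mnm_parity (Q : pred nat) : walk_mnm Q =
  (walk_mnm (fun k => Q k && ~~ odd k) + walk_mnm (fun k => Q k && odd k))%MM.
Proof. by rewrite /walk_mnm (bigID (fun k : 'I_n => odd k)) /= addmC. Qed.

Lemma mdeg_walk_mnm (Q : pred nat) : mdeg (walk_mnm Q) = #|[pred k : 'I_n | Q k]|.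
Proof. by rewrite mdeg_sum -sum1_card; apply: eq_bigr => k _; rewrite mdeg1. Qed.

Lemma walk_mnm_gt0 (Q : pred nat) k : k < n -> Q k -> 0 < walk_mnm Q (e k).
Proof. by move=> kn Qk; rewrite walk_mnmE (bigD1 (Ordinal kn)) //= eqxx. Qed.

Lemma walk_mnm_gt0P (Q : pred nat) i : 0 < walk_mnm Q i -> exists k, [/\ k < n, Q k & e k = i].
Proof.
rewrite walk_mnmE lt0n sum_nat_eq0 => /forallPn[k]; rewrite negb_imply eqb0 negbK.
by move=> /andP[Qk /eqP ki]; exists k.
Qed.

Lemma walk_mnm_le (Q Q' : pred nat) : (forall k, k < n -> Q k -> Q' k) -> (walk_mnm Q <= walk_mnm Q')%MM.
Proof.
move=> QQ'; apply/mnm_lepP => i; rewrite !walk_mnmE big_mkcond [leqRHS]big_mkcond.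
by apply: leq_sum => k _; case: ifP => // /(QQ' _ (ltn_ord k)) ->.
Qed.

Lemma walk_verts_neq k : k < n -> v k != v k.+1.
Proof. by move=> kn; have := Hcard (e k); rewrite Hends // cards2; case: eqP. Qed.

Lemma Amap_walk_mnm Q x :
  Amap ends (walk_mnm Q) x = \sum_(k < n | Q k) ((x == v k) + (x == v k.+1)).
Proof.
rewrite Amap_sum; apply: eq_bigr => k _; rewrite AmapU Hends // !inE.
by case: eqP => //= ->; rewrite (negPf (walk_verts_neq _)).
Qed.

Local Open Scope ring_scope.

Definition signed_count (Q : pred nat) x : int :=
  \sum_(k < n | Q k) (-1) ^+ k * ((x == v k)%:Z + (x == v k.+1)%:Z).

Lemma signed_count_Amap Q x : signed_count Q x =
  (Amap ends (walk_mnm (fun k => Q k && ~~ odd k)) x)%:Z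
  - (Amap ends (walk_mnm (fun k => Q k && odd k)) x)%:Z.
Proof.
rewrite /signed_count (bigID (fun k : 'I_n => odd k)) /= addrC !Amap_walk_mnm.
rewrite !(big_morph Posz PoszD (erefl (0%N : int))) -sumrN.
congr (_ + _); apply: eq_bigr => k /andP[_ ok].
  by rewrite -signr_odd (negPf ok) expr0 mul1r PoszD.
by rewrite -signr_odd ok expr1 mulN1r PoszD.
Qed.

Lemma signed_count_segment i j x : (i <= j <= n)%N ->
  signed_count (fun k => i <= k < j)%N x =
  (-1) ^+ i * (x == v i)%:Z - (-1) ^+ j * (x == v j)%:Z.
Proof.
move=> /andP[ij jn]; rewrite /signed_count.
rewrite -(big_mkord (fun k => (i <= k < j)%N)
  (fun k => (-1) ^+ k * ((x == v k)%:Z + (x == v k.+1)%:Z))).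
rewrite (eq_bigl (fun k => (k < j)%N && (i <= k)%N)) => [|k]; last by rewrite andbC.
rewrite -(big_nat_widenl i 0 n (fun k => k < j)%N) // -(big_nat_widen i j n xpredT) //.
elim: j ij jn => [|j IH]; first by rewrite leqn0 => /eqP-> _; rewrite big_geq ?subrr.
rewrite leq_eqVlt => /orP[/eqP<- _|ij jn]; first by rewrite big_geq ?subrr.
by rewrite big_nat_recr //= IH ?(ltnW jn) // exprS mulrDr; ring.
Qed.

Lemma signed_countU (Q Q' : pred nat) x :
    (forall k, Q k -> Q' k -> False) ->
  signed_count (fun k => Q k || Q' k) x = signed_count Q x + signed_count Q' x.
Proof.
move=> QQ'; rewrite /signed_count big_mkcond [X in _ = X + _]big_mkcond.
rewrite [X in _ = _ + X]big_mkcond -big_split; apply: eq_bigr => k _ /=.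
case: (boolP (Q k)) (@QQ' k) => [Qk|_] /=; last by rewrite add0r.
by case: (Q' k) => [H|_]; [case: H | rewrite addr0].
Qed.

Local Close Scope ring_scope.

Hypothesis Hclosed : v n = v 0.
Hypothesis Heven : ~~ odd n.
Local Notation P := (walk_mnm (fun k => ~~ odd k)).
Local Notation M := (walk_mnm odd).
Hypothesis Hneq : P != M.
Hypothesis Hmin : forall u w : 'X_{1..m}, (u <= P)%MM -> (w <= M)%MM ->
    Amap ends u =1 Amap ends w -> u = w \/ (u = P /\ w = M).

Lemma walk_balanced : Amap ends P =1 Amap ends M.
Proof.
move=> x; apply/eqP; rewrite -eqz_nat -subr_eq0.
have := signed_count_Amap xpredT x; rewrite /= => <-.
have -> : signed_count xpredT x = signed_count (fun k => 0 <= k < n) x.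
  by apply: eq_bigl => k; rewrite ltn_ord.
rewrite signed_count_segment ?leqnn // Hclosed -[((-1) ^+ n)%R]signr_odd (negPf Heven) !expr0.
by rewrite subrr.
Qed.

Lemma walk_disjoint i : 0 < P i -> M i = 0.
Proof.
move=> Pi; apply/eqP; rewrite -leqn0 leqNgt; apply/negP => Mi.
have UP : (U_(i) <= P)%MM by apply/mnm_lepP => j; rewrite mnm1E; case: eqP => // <-.
have UM : (U_(i) <= M)%MM by apply/mnm_lepP => j; rewrite mnm1E; case: eqP => // <-.
have [|/eqP|[_ MU]] := Hmin (lem_subr P U_(i)) (lem_subr M U_(i)).
- by move=> x; rewrite !AmapB // walk_balanced.
- by rewrite -(eqm_add2r U_(i)) !submK // (negPf Hneq).
- by move/mnmP/(_ i): MU; rewrite mnmBE mnm1E eqxx; lia.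
Qed.

Lemma walk_parity k l : k < n -> l < n -> e k = e l -> odd k = odd l.
Proof.
move=> kn ln ekl; apply/eqP; apply: contraT.
suff H a b : a < n -> b < n -> e a = e b -> ~~ odd a -> odd b -> False.
  by case ok: (odd k); case ol: (odd l) => // _; [case: (H l k) | case: (H k l)]; rewrite ?ok ?ol.
move=> an bn eab oa ob; have := walk_mnm_gt0 (Q := odd) bn ob.
by rewrite -eab walk_disjoint // (walk_mnm_gt0 (Q := fun k => ~~ odd k)).
Qed.

Lemma balanced_positions (Q : pred nat) : (forall x, signed_count Q x = 0%R) ->
  (exists2 k, k < n & Q k) -> forall k, k < n -> Q k.
Proof.
move=> Q0 [k0 k0n Qk0] k kn.
pose Q0' := walk_mnm (fun k => Q k && ~~ odd k); pose Q1' := walk_mnm (fun k => Q k && odd k).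
have [||x|EQ|[EP EM]] := Hmin (u := Q0') (w := Q1').
- by apply: walk_mnm_le => ? _ /andP[].
- by apply: walk_mnm_le => ? _ /andP[].
- by have /eqP := Q0 x; rewrite signed_count_Amap subr_eq0 => /eqP[].
- have [i [Pi Mi]] : exists i, 0 < Q0' i /\ 0 < Q1' i.
    exists (e k0); case ok : (odd k0).
      by rewrite EQ walk_mnm_gt0 // Qk0 ok.
    by rewrite -EQ walk_mnm_gt0 // Qk0 ok.
  have /walk_mnm_gt0P[a [an /andP[_ oa] ea]] := Pi.
  have /walk_mnm_gt0P[b [bn /andP[_ ob] eb]] := Mi.
  by have := walk_parity an bn; rewrite ea eb (negPf oa) ob => /(_ erefl).
have degE : mdeg (walk_mnm Q) = n.
  by rewrite (walk_mnm_parity Q) -/Q0' -/Q1' EP EM -(walk_mnm_parity xpredT) mdeg_walk_mnm card_ord.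
have /subset_cardP/(_ (subset_predT _))/(_ (Ordinal kn)) : #|[pred k : 'I_n | Q k]| = #|'I_n|.
  by rewrite -mdeg_walk_mnm degE card_ord.
by rewrite !inE.
Qed.

(* Otherwise the part of the walk between the two visits would be balanced. *)
Lemma walk_visit_parity i j : i < n -> j < n -> i != j -> v i = v j -> odd i != odd j.
Proof.
wlog ij : i j / i < j => [H|] in_ jn ne vij.
  case: (ltngtP i j) => [ij|ji|E]; first exact: H.
    by rewrite eq_sym H // eq_sym.
  by rewrite E eqxx in ne.
apply/negP => /eqP oij.
have /(_ j jn) : forall k, k < n -> i <= k < j; last by rewrite ltnn andbF.
apply: balanced_positions; last by exists i; rewrite // leqnn.
move=> x; rewrite signed_count_segment ?(ltnW ij) ?(ltnW jn) //.
by rewrite vij -signr_odd oij signr_odd subrr.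
Qed.

(* Otherwise the edges at positions in [a, b) and [c, d) together would be balanced. *)
Lemma walk_no_interlacing a b c d :
  a < b -> b < c -> c < d -> d < n -> v a = v c -> v b = v d -> False.
Proof.
move=> ab bc cd dn vac vbd.
have oac : odd a != odd c by apply: walk_visit_parity => //; lia.
have obd : odd b != odd d by apply: walk_visit_parity => //; lia.
have /(_ b) : forall k, k < n -> (a <= k < b) || (c <= k < d).
  apply: balanced_positions; last by exists a; [lia | rewrite leqnn ab].
  move=> x; rewrite signed_countU => [|k]; last by lia.
  rewrite !signed_count_segment; [|lia..].
  rewrite vac vbd -(signr_odd _ a) -(signr_odd _ b) -(signr_odd _ c) -(signr_odd _ d).
  by move: oac obd; (do 4!case: (odd _)) => //= _ _; rewrite !expr0 !expr1; ring.
by move=> /(_ (ltn_trans bc (ltn_trans cd dn))); lia.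
Qed.

Lemma Amap_walk_visits x : Amap ends P x = #|[set k : 'I_n | v k == x]|.
Proof.
apply: double_inj; rewrite -addnn {2}walk_balanced -AmapD -(walk_mnm_parity xpredT).
rewrite Amap_walk_mnm big_split /=.
rewrite -(big_mkord xpredT (fun k => (x == v k : nat))) -(big_mkord xpredT (fun k => (x == v k.+1 : nat))).
have -> : \sum_(0 <= k < n) (x == v k.+1) = \sum_(0 <= k < n) (x == v k).
  apply: (@addIn (x == v 0)); rewrite [LHS]addnC -(big_nat_recl n 0 (fun k => (x == v k : nat))) //.
  by rewrite big_nat_recr // Hclosed.
rewrite addnn big_mkord -sum1_card big_mkcond; congr _.*2; rewrite [RHS]big_mkcond.
by apply: eq_bigr => k _; rewrite inE eq_sym.
Qed.

Lemma walk_le2 x : Amap ends P x <= 2.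
Proof.
rewrite Amap_walk_visits leqNgt; apply/negP => /card_gt2P[i [j [k [[]]]]].
rewrite !inE => /eqP vi /eqP vj /eqP vk [ij jk ki].
have := walk_visit_parity (ltn_ord i) (ltn_ord j) ij.
have := walk_visit_parity (ltn_ord j) (ltn_ord k) jk.
have := walk_visit_parity (ltn_ord k) (ltn_ord i) ki.
rewrite vi vj vk => /(_ erefl) + /(_ erefl) + /(_ erefl).
by do 3!case: (odd _).
Qed.

Lemma walk_arc_separated i j k l y : i < j -> j < n -> v i = v j ->
    i <= l < j -> k < n -> ~~ (i <= k < j) ->
    y \in ends (e l) -> y \in ends (e k) -> y = v i.
Proof.
move=> ij jn vij lij kn kij; rewrite !Hends //; last by lia.
rewrite !inE => yl yk; apply/eqP; apply: contraT => yvi.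
have [l' l'ij vl'] : exists2 l', i < l' < j & v l' = y.
  case/orP: yl => /eqP yl; [exists l | exists l.+1] => //.
    have : l != i by apply: contraNneq yvi => <-; rewrite yl.
    by lia.
  have : l.+1 != j by apply: contraNneq yvi => E; rewrite vij -E yl.
  by lia.
have [k' k'ij vk'] : exists2 k', (k' < i) || (j < k' < n) & v k' = y.
  case/orP: yk => /eqP yk.
    exists k => //; have : k != j by apply: contraNneq yvi => kj; rewrite vij -kj yk.
    by lia.
  have [kn1|kn1] := eqVneq k.+1 n.
    exists 0; last by rewrite -Hclosed -kn1.
    have : i != 0 by apply: contraNneq yvi => ->; rewrite -Hclosed -kn1 yk.
    by lia.
  exists k.+1 => //; have : k.+1 != i by apply: contraNneq yvi => <-; rewrite yk.
  by lia.
case/orP: k'ij => k'ij.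
  by case: (@walk_no_interlacing k' i l' j) => //; rewrite ?vk' ?vl' //; lia.
by case: (@walk_no_interlacing i l' j k') => //; rewrite ?vk' ?vl' //; lia.
Qed.

Lemma walk_separation x : Amap ends P x = 2 -> exists L, separates ends P M x L.
Proof.
rewrite Amap_walk_visits => /eqP/cards2P[i0 [j0 [ij0 EI]]].
wlog lt_ij : i0 j0 ij0 EI / i0 < j0 => [H|].
  case: (ltngtP i0 j0) => [|ji|/val_inj E]; [exact: H| |by rewrite E eqxx in ij0].
  by apply: (H j0 i0) => //; [rewrite eq_sym | rewrite EI setUC].
have visit k : k < n -> v k = x -> (k == i0) || (k == j0).
  move=> kn vk; have : Ordinal kn \in [set k : 'I_n | v k == x] by rewrite inE vk.
  by rewrite EI !inE -!val_eqE.
have vi : v i0 = x by have := set21 i0 j0; rewrite -EI inE => /eqP.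
have vj : v j0 = x by have := set22 i0 j0; rewrite -EI inE => /eqP.
move: (nat_of_ord i0) (nat_of_ord j0) lt_ij (ltn_ord j0) vi vj visit => i j ij jn vi vj visit {i0 j0 ij0 EI}.
have oij : odd i != odd j by apply: walk_visit_parity; rewrite ?vi ?vj //; lia.
pose arc k := i <= k < j.
have arcP k l y : k < n -> l < n -> arc l -> ~~ arc k -> y \in ends (e l) -> y \in ends (e k) -> y = x.
  move=> kn ln al nak yl yk; rewrite -vi.
  by apply: (walk_arc_separated (k := k) (l := l) (j := j)); rewrite // vi vj.
have atx k : k < n -> x \in ends (e k) -> arc k = (odd k == odd i).
  move=> kn; rewrite Hends // !inE => /orP[]/eqP/esym vk.
    by rewrite /arc; case/orP: (visit k kn vk) oij => /eqP ->; lia.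
  have [kn1|kn1] := eqVneq k.+1 n.
    have v0 : v 0 = x by rewrite -Hclosed -kn1.
    have i0 : i = 0 by have := visit 0; rewrite v0 => /(_ _ erefl); lia.
    by rewrite /arc i0; lia.
  have k1n : k.+1 < n by lia.
  by rewrite /arc; have := visit _ k1n vk; lia.
pose L0 : {set 'I_m} := [set e k | k : 'I_n & arc k].
have inL0 k : k < n -> (e k \in L0) = arc k.
  move=> kn; apply/imsetP/idP => [[l]|ak]; last by exists (Ordinal kn); rewrite ?inE.
  rewrite inE => al ekl; apply: contraT => nak.
  have := Hcard (e k); rewrite (_ : ends (e k) = [set x]) ?cards1 //.
  suff all_x y : y \in ends (e k) -> y = x.
    apply/setP => y; rewrite inE; apply/idP/eqP => [/all_x//|->].
    by have := set21 (v k) (v k.+1); rewrite -Hends // => H; rewrite -(all_x _ H).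
  by move=> yk; apply: (arcP k l) => //; rewrite -ekl.
have sepL0 f g y : 0 < P f + M f -> 0 < P g + M g -> f \in L0 -> g \notin L0 ->
    y \in ends f -> y \in ends g -> y = x.
  have pos h : 0 < P h + M h -> exists2 k, k < n & e k = h.
    by rewrite addn_gt0 => /orP[]/walk_mnm_gt0P[k [kn _ <-]]; exists k.
  move=> /pos[l ln <-] /pos[k kn <-]; rewrite !inL0 // => al nak yl yk.
  exact: (arcP k l).
have Pat f : x \in ends f -> 0 < P f -> (f \in L0) = ~~ odd i.
  by move=> xf /walk_mnm_gt0P[k [kn ok kf]]; rewrite -kf inL0 // atx ?kf // (negPf ok); case: odd.
have Mat f : x \in ends f -> 0 < M f -> (f \in L0) = odd i.
  by move=> xf /walk_mnm_gt0P[k [kn ok kf]]; rewrite -kf inL0 // atx ?kf // ok; case: odd.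
case oi : (odd i); last first.
  by exists L0; split => // f xf f0; [rewrite Pat // oi | rewrite Mat // oi].
exists (~: L0); split.
- by move=> f xf f0; rewrite inE Pat // oi.
- by move=> f xf f0; rewrite inE negbK Mat // oi.
by move=> f g y Wf Wg; rewrite !inE negbK => fL gL yf yg; apply: (sepL0 g f).
Qed.

Lemma walk_primitive_pair : primitive_pair ends P M.
Proof.
split; [exact: walk_balanced | exact: Hmin | exact: walk_disjoint | exact: Hneq
  | exact: walk_le2 | exact: walk_separation].
Qed.

End Walk.

Section FromWalk.
Variables (K : fieldType) (V : finType) (m : nat) (ends : 'I_m -> {set V}).
Hypothesis Hcard : forall k, #|ends k| = 2.

Lemma count_mem_positions (f : pred nat) (es : seq 'I_m) e0 i :
  count_mem i [seq p.2 | p <- zip (iota 0 (size es)) es & f p.1] =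
  \sum_(k < size es | f k) (nth e0 es k == i).
Proof.
have -> : zip (iota 0 (size es)) es = [seq (k, nth e0 es k) | k <- iota 0 (size es)].
  by rewrite -{2}(mkseq_nth e0 es) /mkseq; elim: (iota 0 (size es)) => //= k s ->.
rewrite filter_map -map_comp count_map -sum1_count big_filter_cond /=.
rewrite -(big_mkord f (fun k => (nth e0 es k == i : nat))) /index_iota subn0.
rewrite big_mkcond [RHS]big_mkcond; apply: eq_bigr => k _ /=.
by case: (f k) => //=; case: eqP.
Qed.

Lemma binomial_inj (u v P M : 'X_{1..m}) : u != v -> P != M ->
  ('X_[u] - 'X_[v] : {mpoly K[m]})%R = ('X_[P] - 'X_[M])%R ->
  (u = P /\ v = M) \/ (u = M /\ v = P).
Proof.
move=> uv PM E; have H w : (w == u) || (w == v) = (w == P) || (w == M).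
  by have := msupp_binomialE K uv w; rewrite E msupp_binomialE // !inE.
have := H u; have := H v; rewrite !eqxx orbT /=.
move=> /esym/orP[]/eqP vE /esym/orP[]/eqP uE; subst; rewrite ?eqxx // in uv *.
  by right.
by left.
Qed.

Lemma Eplus_walk_mnm e0 (es : seq 'I_m) :
  Eplus es = walk_mnm (size es) (nth e0 es) (fun k => ~~ odd k).
Proof. by apply/mnmP => i; rewrite mnmE walk_mnmE -(count_mem_positions (fun k => ~~ odd k)). Qed.

Lemma Eminus_walk_mnm e0 (es : seq 'I_m) :
  Eminus es = walk_mnm (size es) (nth e0 es) odd.
Proof. by apply/mnmP => i; rewrite mnmE walk_mnmE -(count_mem_positions odd). Qed.

Lemma in_wplus (es : seq 'I_m) i : (i \in wplus es) = (0 < Eplus es i).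
Proof. by rewrite inE mnmE -has_count has_pred1. Qed.

Lemma in_wminus (es : seq 'I_m) i : (i \in wminus es) = (0 < Eminus es i).
Proof. by rewrite inE mnmE -has_count has_pred1. Qed.

Lemma in_wedges (es : seq 'I_m) i : (i \in wedges es) = (0 < Eplus es i + Eminus es i).
Proof.
have [e0 _|] := pickP 'I_m; last by case: es => [_|x s /(_ x)//]; rewrite inE !mnmE.
rewrite inE (Eplus_walk_mnm e0) (Eminus_walk_mnm e0) addn_gt0; apply/idP/orP.
  move=> ies; rewrite -(nth_index e0 ies); case o : (odd (index i es)).
    by right; apply: walk_mnm_gt0; rewrite ?index_mem ?o.
  by left; apply: walk_mnm_gt0; rewrite ?index_mem ?o.
by case=> /walk_mnm_gt0P[k [kn _ <-]]; apply: mem_nth.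
Qed.

Lemma all2_zip_nth (es : seq 'I_m) (vs : seq V) e0 x0 :
    size vs = (size es).+1 ->
    all2 (fun e p => ends e == [set p.1; p.2]) es (zip vs (behead vs)) ->
  forall k, k < size es -> ends (nth e0 es k) = [set nth x0 vs k; nth x0 vs k.+1].
Proof.
elim: es vs => [|e es IH] [|x [|y vs]] //= [sz] /andP[/eqP exy H] [|k] kn //=.
by apply: (IH (y :: vs)) => //=; rewrite sz.
Qed.

Lemma primitive_walk_pair (es : seq 'I_m) vs :
    even_closed_walk ends es vs -> primitive ends K es ->
  primitive_pair ends (Eplus es) (Eminus es).
Proof.
move=> [[es0 [szvs Hes]] [x0 [r [vsE xr]]] ev] [PM Hprim].
have [e0 _|] := pickP 'I_m; last by case: es es0 {szvs Hes ev PM Hprim} => // x s _ /(_ x).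
have Hends := all2_zip_nth e0 x0 szvs Hes.
rewrite (Eplus_walk_mnm e0) (Eminus_walk_mnm e0) in PM Hprim *.
apply: (walk_primitive_pair Hcard Hends) => //.
  by move: szvs; rewrite vsE => -[<-]; rewrite -last_nth.
move=> u v uP vM uv; have [->|neuv] := eqVneq u v; [by left|right].
have := Hprim u v neuv (toric_ideal_binomial K uv) (proj2 (mdividesP _ _) uP) (proj2 (mdividesP _ _) vM).
rewrite /Bw (Eplus_walk_mnm e0) (Eminus_walk_mnm e0) => /(binomial_inj neuv PM)[//|[uE vE]].
by case/eqP: neuv; rewrite vE; apply: (mnm_le_mdeg uP); rewrite (eq_Amap_mdeg Hcard uv) vE.
Qed.

End FromWalk.

(** * Pure cycles obstruct Gröbner bases *)

Section Adjacency.
Variables (V : finType) (m : nat) (ends : 'I_m -> {set V}).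

Lemma adjFP (F : {set 'I_m}) x y :
  reflect (exists2 k, k \in F & ends k = [set x; y]) (adjF ends F x y).
Proof. exact: (iffP exists_eq_inP). Qed.

Lemma adjF_sym (F : {set 'I_m}) : ssrbool.symmetric (adjF ends F).
Proof. by move=> x y; apply/adjFP/adjFP => -[k kF kE]; exists k; rewrite // setUC. Qed.

Lemma connect_adjF_sym (F : {set 'I_m}) : connect_sym (adjF ends F).
Proof. exact/sym_connect_sym/adjF_sym. Qed.

Lemma connect_invariant (r : rel V) (Q : V -> Prop) x y :
  (forall a b, r a b -> Q a -> Q b) -> connect r x y -> Q x -> Q y.
Proof.
move=> H /connectP[p]; elim: p x => [|z p IH] x /= => [_ -> //|/andP[xz zp] yE Qx].
by apply: (IH z) => //; apply: H xz Qx.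
Qed.

Hypothesis Hcard : forall k, #|ends k| = 2.

Lemma ends_pair k x y : x \in ends k -> y \in ends k -> x != y -> ends k = [set x; y].
Proof.
move=> xk yk xy; apply/esym/eqP; rewrite eqEcard Hcard cards2 xy andbT.
by apply/subsetP => z; rewrite !inE => /orP[]/eqP->.
Qed.

Lemma connect_ends (F : {set 'I_m}) k x y :
  k \in F -> x \in ends k -> y \in ends k -> connect (adjF ends F) x y.
Proof.
move=> kF xk yk; have [->|xy] := eqVneq x y; first exact: connect0.
by apply/connect1/adjFP; exists k; rewrite // (ends_pair xk yk).
Qed.

Variables (P M : 'X_{1..m}).

Lemma separates_connect x L (F : {set 'I_m}) y z :
    separates ends P M x L -> (forall k, k \in F -> 0 < P k + M k) ->
    connect (adjF ends [set k in F | x \notin ends k]) y z ->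
    (exists e, [/\ 0 < P e + M e, e \in L & y \in ends e]) ->
  exists e, [/\ 0 < P e + M e, e \in L & z \in ends e].
Proof.
move=> [_ _ sep] FW.
apply: (connect_invariant (Q := fun y => exists e, [/\ 0 < P e + M e, e \in L & y \in ends e]))
  => a b /adjFP[f]; rewrite inE => /andP[fF xf] fE.
move=> [e [We eL ae]]; exists f; rewrite fE set22 FW //; split=> //.
have af : a \in ends f by rewrite fE set21.
by apply: contraNT xf => fL; rewrite -(sep e f a) //; apply: FW.
Qed.

Definition restrict (Q : {set 'I_m}) (u : 'X_{1..m}) : 'X_{1..m} :=
  [multinom if i \in Q then u i else 0 | i < m].

Lemma Amap_restrict_all (Q : {set 'I_m}) (u : 'X_{1..m}) y :
  (forall e, y \in ends e -> 0 < u e -> e \in Q) -> Amap ends (restrict Q u) y = Amap ends u y.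
Proof.
move=> H; apply: eq_bigr => e ye; rewrite mnmE; case: ifP => // eQ.
by apply/esym/eqP; rewrite -leqn0 leqNgt; apply/negP => /(H _ ye); rewrite eQ.
Qed.

Lemma Amap_restrict_none (Q : {set 'I_m}) (u : 'X_{1..m}) y :
  (forall e, y \in ends e -> 0 < u e -> e \notin Q) -> Amap ends (restrict Q u) y = 0.
Proof.
move=> H; apply: big1 => e ye; rewrite mnmE; case: ifP => // eQ.
by apply/eqP; rewrite -leqn0 leqNgt; apply/negP => /(H _ ye); rewrite eQ.
Qed.

Lemma Amap_gt0 (u : 'X_{1..m}) x : 0 < Amap ends u x -> exists2 e, x \in ends e & 0 < u e.
Proof.
rewrite lt0n sum_nat_eq0 => /forallPn[e]; rewrite negb_imply -lt0n => /andP[xe ue].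
by exists e.
Qed.

End Adjacency.

Lemma mnm_sum_shift m (t : nat) (f : nat -> 'X_{1..m}) : f t = f 0 ->
  (\sum_(i < t) f i.+1)%MM = (\sum_(i < t) f i)%MM.
Proof.
move=> ft; apply: (@addIm _ (f 0)); rewrite -{2}ft addmC.
have := big_ord_recl t (fun i : 'I_t.+1 => f i) (op := +%MM) (idx := 0%MM).
by rewrite big_ord_recr /= => <-.
Qed.

Section PureCycle.
Variables (V : finType) (m : nat) (ends : 'I_m -> {set V}).
Hypothesis Hcard : forall k, #|ends k| = 2.
Variables (P M : 'X_{1..m}).
Hypothesis HPM : primitive_pair ends P M.
Variables (t : nat) (X : nat -> V) (eps : nat -> 'I_m) (F : {set 'I_m}).
Hypotheses (Ht : 2 < t) (X_per : forall i, X (i + t) = X i)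
  (X_inj : forall i j, i < t -> j < t -> X i = X j -> i = j)
  (eps_per : forall i, eps (i + t) = eps i)
  (Heps : forall i, ends (eps i) = [set X i; X i.+1])
  (epsF : forall i, eps i \in F)
  (Feps : forall e, e \in F -> exists i, e = eps i)
  (FP : forall e, e \in F -> 0 < P e)
  (Hnocut : forall x i j, X i != x -> X j != x ->
     connect (adjF ends [set k in F | x \notin ends k]) (X i) (X j)).

Lemma X_mod i : X i = X (i %% t).
Proof.
rewrite {1}(divn_eq i t) addnC; elim: (i %/ t) => [|q IH]; first by rewrite addn0.
by rewrite mulSnr addnA X_per.
Qed.

Lemma X_eq i j : X i = X j -> i = j %[mod t].
Proof. by rewrite (X_mod i) (X_mod j) => /X_inj; apply; rewrite ltn_mod; lia. Qed.

Lemma X_neq i k : 0 < k < t -> X i != X (i + k).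
Proof.
move=> kt; apply/eqP => /X_eq/eqP; rewrite -{1}(addn0 i) eqn_modDl mod0n modn_small; lia.
Qed.

Lemma eps_eq i j : eps i = eps j -> i = j %[mod t].
Proof.
move=> E; have := set21 (X i) (X i.+1); rewrite -Heps E Heps !inE => /orP[]/eqP/X_eq // ij1.
have := set22 (X i) (X i.+1); rewrite -Heps E Heps !inE => /orP[]/eqP Xij.
  have j2 : X j != X j.+2 by rewrite -(addn2 j) X_neq //; lia.
  case/eqP: j2; rewrite -Xij.
  by rewrite X_mod -addn1 -modnDml ij1 modnDml addn1 -X_mod.
by move/X_eq/eqP: Xij; rewrite -(addn1 i) -(addn1 j) eqn_modDr => /eqP.
Qed.

Lemma eps_neq i k : 0 < k < t -> eps i != eps (i + k).
Proof.
move=> kt; apply/eqP => /eps_eq/eqP; rewrite -{1}(addn0 i) eqn_modDl mod0n modn_small; lia.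
Qed.

Lemma Amap_ge_pair i : P (eps i) + P (eps i.+1) +
  \sum_(e < m | [&& X i.+1 \in ends e, e != eps i & e != eps i.+1]) P e <= 2.
Proof.
have eps_i : eps i != eps i.+1 by rewrite -addn1 eps_neq //; lia.
apply: leq_trans (pp_le2 HPM (X i.+1)); rewrite /Amap [leqRHS](bigD1 (eps i)) ?Heps ?set22 //=.
rewrite [X in _ <= _ + X](bigD1 (eps i.+1)) ?Heps ?set21 1?eq_sym //= addnA leq_add2l.
by apply: eq_leq; apply: eq_bigl => e; rewrite andbA.
Qed.

Lemma X_pred i : exists j, X i = X j.+1.
Proof. by exists (i + t).-1; rewrite prednK ?X_per //; lia. Qed.

Lemma P_at_cycle i e : X i \in ends e -> 0 < P e -> e \in F.
Proof.
have [j ->] := X_pred i => xe Pe; apply: contraT => eF.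
have := Amap_ge_pair j; have := FP (epsF j); have := FP (epsF j.+1).
rewrite (bigD1 e) /=; first by lia.
by rewrite xe /=; apply/andP; split; apply: contraNneq eF => ->.
Qed.

Lemma Amap_cycle i : Amap ends P (X i) = 2.
Proof.
have [j ->] := X_pred i; apply/eqP; rewrite eqn_leq (pp_le2 HPM) /=.
have eps_j : eps j != eps j.+1 by rewrite -addn1 eps_neq //; lia.
rewrite /Amap (bigD1 (eps j)) ?Heps ?set22 //=.
rewrite (bigD1 (eps j.+1)) ?Heps ?set21 1?eq_sym //=.
by have := FP (epsF j); have := FP (epsF j.+1); lia.
Qed.

Lemma M_cycle e : e \in F -> M e = 0.
Proof. by move/FP/(pp_disjoint HPM). Qed.

Definition offcycle : {set 'I_m} := [set e | (0 < P e + M e) && (e \notin F)].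

Local Notation offconn := (connect (adjF ends offcycle)).

Lemma offcycle_connect i j : offconn (X i) (X j) -> X i = X j.
Proof.
move=> cij; have [L [PL ML sepL]] := pp_separation HPM (Amap_cycle i).
have [//|[e [We eL je]]] : X j = X i \/ exists e, [/\ 0 < P e + M e, e \notin L & X j \in ends e].
  apply: (connect_invariant (Q := fun y => y = X i \/
    exists e, [/\ 0 < P e + M e, e \notin L & y \in ends e]) _ cij); last by left.
  move=> a b /adjFP[f]; rewrite inE => /andP[Wf fF] fE aQ; right; exists f.
  rewrite fE set22; split=> //.
  have af : a \in ends f by rewrite fE set21.
  case: aQ => [a_i|[e [We eL ae]]]; last first.
    have [a_i|a_i] := eqVneq a (X i).
      apply: ML; rewrite -?a_i //; move: Wf; rewrite addn_gt0 => /orP[Pf|//].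
      by move: (P_at_cycle (i := i)); rewrite -a_i => /(_ f af Pf); rewrite (negPf fF).
    apply: contra a_i => fL; apply/eqP; exact: (sepL f e a).
  apply: ML; rewrite -?a_i //; move: Wf; rewrite addn_gt0 => /orP[Pf|//].
  by move: (P_at_cycle (i := i)); rewrite -a_i => /(_ f af Pf); rewrite (negPf fF).
apply/eqP; apply: contraT => neij; rewrite eq_sym in neij.
have i1 : X i.+1 != X i by rewrite eq_sym -addn1 X_neq //; lia.
have FW k : k \in F -> 0 < P k + M k by move/FP; lia.
have [|f [Wf fL jf]] := separates_connect (And3 PL ML sepL) FW (Hnocut i1 neij).
  exists (eps i); rewrite FW ?epsF // Heps set22; split=> //.
  by apply: PL; rewrite ?Heps ?set21 ?FP.
by rewrite (sepL f e (X j)) // eqxx in neij.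
Qed.

Definition hanging i : {set 'I_m} :=
  [set e in offcycle | [exists y in ends e, offconn (X i) y]].

Lemma hangingP i e y : e \in offcycle -> y \in ends e -> (e \in hanging i) = offconn (X i) y.
Proof.
move=> eo ye; rewrite inE eo /=; apply/exists_inP/idP => [[z ze iz]|iy]; last by exists y.
exact: connect_trans iz (connect_ends Hcard eo ze ye).
Qed.

Lemma hanging_disjoint i j e : e \in hanging i -> e \in hanging j -> X i = X j.
Proof.
move=> ei ej; have eo : e \in offcycle by move: ei; rewrite inE => /andP[].
have [y ye] : exists y, y \in ends e by apply/card_gt0P; rewrite Hcard.
apply: offcycle_connect; apply: connect_trans (_ : offconn (X i) y) _.
  by rewrite -(hangingP _ eo).
by rewrite connect_adjF_sym -(hangingP _ eo).
Qed.

Lemma hanging_offcycle i e : e \in hanging i -> e \notin F.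
Proof. by rewrite !inE => /andP[/andP[]]. Qed.

Definition hangP i := restrict (hanging i) P.
Definition hangM i := restrict (hanging i) M.

Lemma hang_balanced i y : Amap ends (hangM i) y = Amap ends (hangP i) y + (y == X i).*2.
Proof.
have [yi|yi] := eqVneq y (X i).
  rewrite yi [X in X + _]Amap_restrict_none => [|e ie Pe]; last first.
    by apply: contraL (P_at_cycle ie Pe) => /hanging_offcycle.
  rewrite Amap_restrict_all => [|e ie Me]; first by rewrite -(pp_balanced HPM) Amap_cycle.
  rewrite (hangingP i (y := X i)) ?connect0 // inE addn_gt0 Me orbT /=.
  by apply: contraTN Me => /M_cycle ->.
rewrite addn0; have [ciy|nciy] := boolP (offconn (X i) y); last first.
  have none e : y \in ends e -> e \notin hanging i.
    move=> ye; apply: contra nciy => eh; rewrite -(hangingP _ _ ye) //.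
    by move: eh; rewrite inE => /andP[].
  by rewrite /hangM /hangP !Amap_restrict_none // => e ye _; apply: none.
have all e : y \in ends e -> 0 < P e + M e -> e \in hanging i.
  move=> ye We; have eo : e \in offcycle; last by rewrite (hangingP _ eo ye).
  rewrite inE We; apply/negP => /Feps[j eE]; case/eqP: yi.
  by move: ye ciy; rewrite eE Heps !inE => /orP[]/eqP-> /offcycle_connect ->.
rewrite /hangM /hangP !Amap_restrict_all ?(pp_balanced HPM) // => e ye ue; apply: all => //;
  by rewrite addn_gt0 ue ?orbT.
Qed.

Lemma hangP_cycle i e : e \in F -> hangP i e = 0.
Proof. by move=> eF; rewrite mnmE; case: ifP => // /hanging_offcycle; rewrite eF. Qed.

Lemma hangM_cycle i e : e \in F -> hangM i e = 0.
Proof. by move=> eF; rewrite mnmE; case: ifP => // /hanging_offcycle; rewrite eF. Qed.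

Lemma M_edge_at i : exists2 e, e \in hanging i & 0 < M e.
Proof.
have : 0 < Amap ends M (X i) by rewrite -(pp_balanced HPM) Amap_cycle.
case/Amap_gt0 => e ie Me; exists e; rewrite // (hangingP _ _ ie) ?connect0 //.
by rewrite inE addn_gt0 Me orbT; apply: contraTN Me => /M_cycle ->.
Qed.

Lemma hang_per i : hangP (i + t) = hangP i /\ hangM (i + t) = hangM i.
Proof. by rewrite /hangP /hangM /hanging X_per. Qed.

Variable lt : rel 'X_{1..m}.
Hypothesis Hlt : monomial_order lt.
Hypothesis HstP : forall d, (d <= P)%MM -> d != P -> standard ends lt d.
Hypothesis HstM : forall d, (d <= M)%MM -> d != M -> standard ends lt d.

Lemma standard_lt d c : standard ends lt d -> Amap ends c =1 Amap ends d -> d != c -> lt d c.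
Proof.
by move=> /(standardP Hcard) Sd /Sd/negPf ncd /(mlt_total Hlt); rewrite ncd orbF.
Qed.

Local Notation cycle_mnm := (\sum_(i < t) U_(eps i))%MM.

Lemma hangM_lt : lt (\sum_(i < t) hangM i)%MM (cycle_mnm + \sum_(i < t) hangP i)%MM.
Proof.
pose d i := (hangM i + hangM i.+1)%MM.
pose c i := (U_(eps i) + hangP i + (U_(eps i) + hangP i.+1))%MM.
have dc i : lt (d i) (c i).
  apply: standard_lt.
  - apply: HstM.
      apply/mnm_lepP => e; rewrite mnmDE !mnmE.
      case: ifP => ei; case: ifP => ej; rewrite ?addn0 //.
      have := X_neq i (k := 1); rewrite addn1 => /(_ _)/eqP; case; first by lia.
      exact: hanging_disjoint ei ej.
    have [e eh Me] := M_edge_at i.+2; apply: contraTneq Me => /mnmP/(_ e) <-.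
    rewrite mnmDE !mnmE -leqNgt; case: ifP => ei.
      have := X_neq i (k := 2); rewrite addn2 => /(_ _)/eqP; case; first by lia.
      exact: hanging_disjoint ei eh.
    case: ifP => // ej.
    have := X_neq i.+1 (k := 1); rewrite addn1 => /(_ _)/eqP; case; first by lia.
    exact: hanging_disjoint ej eh.
  - move=> x; rewrite !AmapD !hang_balanced AmapU Heps !inE.
    have : X i != X i.+1 by rewrite -[i.+1]addn1 X_neq //; lia.
    by case: (eqVneq x (X i)) => [->|_]; case: (x == X i.+1) => //=; rewrite ?eqxx; try lia; case: eqP; lia.
  apply/eqP => /mnmP/(_ (eps i)); rewrite !mnmDE mnm1E eqxx.
  by rewrite !hangM_cycle.
have t0 : t = t.-1.+1 by lia.
apply: (mlt_double Hlt).
have := mlt_sum Hlt (n := t.-1) (f := d) (g := c) (fun i _ => dc i).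
rewrite -t0 /d /c !big_split /=.
have [hp0 hm0] := hang_per 0; rewrite add0n in hp0 hm0.
rewrite (mnm_sum_shift hp0) (mnm_sum_shift hm0).
by [].
Qed.

Definition arc_mnm i (Q : pred nat) := walk_mnm t (fun k => eps (i + k)) Q.

Lemma arc_mnm_cycle i Q e : 0 < arc_mnm i Q e -> e \in F.
Proof. by move/walk_mnm_gt0P => [k [_ _ <-]]. Qed.

Lemma arc_mnm_pos i (Q : pred nat) k : k < t -> (0 < arc_mnm i Q (eps (i + k))) = Q k.
Proof.
move=> kt; apply/idP/idP => [/walk_mnm_gt0P[l [lt_ Ql /eps_eq/eqP]]|Qk].
  by rewrite eqn_modDl !modn_small // => /eqP <-.
exact: (@walk_mnm_gt0 _ t (fun k => eps (i + k)) Q k).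
Qed.

Lemma arc_mnm_le i Q : (arc_mnm i Q <= P)%MM.
Proof.
apply/mnm_lepP => e; have [E|a0] := posnP (arc_mnm i Q e); first by rewrite E.
have [k [kt Qk ek]] := walk_mnm_gt0P a0; apply: leq_trans (FP (arc_mnm_cycle a0)).
rewrite /arc_mnm walk_mnmE (bigD1 (Ordinal kt)) //= big1 ?addn0 ?leq_b1 // => l /andP[_ lk].
apply/eqP; rewrite eqb0; apply: contra lk => /eqP el; rewrite -val_eqE /=.
move: el; rewrite -ek => /eps_eq/eqP; rewrite eqn_modDl !modn_small // => /eqP->.
Qed.

Lemma arc_Amap i x : Amap ends (arc_mnm i (fun k => ~~ odd k)) x =
  Amap ends (arc_mnm i odd) x + (if odd t then (x == X i).*2 else 0).
Proof.
have Hends k : k < t -> ends (eps (i + k)) = [set X (i + k); X (i + k.+1)].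
  by rewrite addnS.
have := signed_count_Amap Hcard Hends xpredT x.
rewrite /= -!/(arc_mnm i _) -[arc_mnm i [eta odd]]/(arc_mnm i odd).
have -> : signed_count t (fun k => X (i + k)) xpredT x =
    signed_count t (fun k => X (i + k)) (fun k => 0 <= k < t) x.
  by apply: eq_bigl => k; rewrite ltn_ord.
rewrite signed_count_segment ?leqnn // addn0 X_per -[((-1) ^+ t)%R]signr_odd expr0.
by case: (odd t) => /=; case: (x == X i) => /=; lia.
Qed.

Lemma cycle_odd : odd t.
Proof.
apply: contraT => et.
have A i : Amap ends (arc_mnm i (fun k => ~~ odd k)) =1 Amap ends (arc_mnm i odd).
  by move=> x; rewrite arc_Amap (negPf et) addn0.
have even0 : 0 < arc_mnm 0 (fun k => ~~ odd k) (eps 0) by rewrite -[X in eps X]addn0 arc_mnm_pos //; lia.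
have odd0 : arc_mnm 0 odd (eps 0) = 0.
  by apply/eqP; rewrite -leqn0 leqNgt -[X in eps X]addn0 arc_mnm_pos //; lia.
have even1 : arc_mnm 0 (fun k => ~~ odd k) (eps 1) = 0.
  by apply/eqP; rewrite -leqn0 leqNgt -[X in eps X]add0n arc_mnm_pos //; lia.
have Seven : standard ends lt (arc_mnm 0 (fun k => ~~ odd k)).
  apply: HstP; first exact: arc_mnm_le.
  by apply: contraTneq (FP (epsF 1)) => <-; rewrite even1.
have Sodd : standard ends lt (arc_mnm 0 odd).
  apply: HstP; first exact: arc_mnm_le.
  by apply: contraTneq (FP (epsF 0)) => <-; rewrite odd0.
by move: even0; rewrite (standard_uniq Hcard Hlt Seven Sodd (A 0)) odd0.
Qed.

Lemma arc_shift i : arc_mnm i.+1 (fun k => ~~ odd k) = (arc_mnm i odd + U_(eps i))%MM.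
Proof.
rewrite -(eps_per i) /arc_mnm /walk_mnm.
have H := big_ord_recr t (fun k : 'I_t.+1 => if odd k then U_(eps (i + k))%MM else 0%MM)
  (op := +%MM) (idx := 0%MM).
rewrite [in RHS]big_mkcond /=; move: H; rewrite /= cycle_odd => <-.
rewrite big_ord_recl /= add0m big_mkcond; apply: eq_bigr => k _.
by rewrite addSnnS.
Qed.

Lemma hangP_lt : lt (cycle_mnm + \sum_(i < t) hangP i)%MM (\sum_(i < t) hangM i)%MM.
Proof.
pose d i := (arc_mnm i (fun k => ~~ odd k) + hangP i)%MM.
pose c i := (arc_mnm i odd + hangM i)%MM.
have dc i : lt (d i) (c i).
  apply: standard_lt.
  - apply: HstP.
      apply/mnm_lepP => e; rewrite mnmDE; have [eF|eF] := boolP (e \in F).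
        by rewrite hangP_cycle // addn0 (mnm_lepP (arc_mnm_le _ _)).
      rewrite (_ : arc_mnm _ _ e = 0) ?add0n; first by rewrite mnmE; case: ifP.
      by apply/eqP; rewrite -leqn0 leqNgt; apply: contra eF => /arc_mnm_cycle.
    apply: contraTneq (FP (epsF i.+1)) => <-; rewrite mnmDE hangP_cycle // addn0.
    by rewrite -[i.+1]addn1 arc_mnm_pos //; lia.
  - by move=> x; rewrite !AmapD hang_balanced arc_Amap cycle_odd; lia.
  have [e eh Me] := M_edge_at i; apply/eqP => /mnmP/(_ e); rewrite !mnmDE !mnmE eh.
  have Pe : P e = 0 by apply: (pp_disjoint (primitive_pair_sym HPM)).
  have eF := hanging_offcycle eh.
  have arc0 Q : arc_mnm i Q e = 0.
    by apply/eqP; rewrite -leqn0 leqNgt; apply: contra eF => /arc_mnm_cycle.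
  by rewrite !arc0 Pe; lia.
have t0 : t = t.-1.+1 by lia.
have := mlt_sum Hlt (n := t.-1) (f := d) (g := c) (fun i _ => dc i).
rewrite -t0 /d /c !big_split /=.
have arc_per : arc_mnm t (fun k => ~~ odd k) = arc_mnm 0 (fun k => ~~ odd k).
  by apply: eq_bigr => k _; rewrite add0n addnC eps_per.
rewrite -(mnm_sum_shift (f := fun i => arc_mnm i (fun k => ~~ odd k)) arc_per) /=; under eq_bigr do rewrite arc_shift.
rewrite big_split /= -addmA ![(\sum_(i < t) arc_mnm i odd + _)%MM]addmC.
by rewrite (mlt_add2r Hlt).
Qed.

Lemma pure_cycle_false : False.
Proof. by have := mlt_trans Hlt hangM_lt hangP_lt; rewrite (mlt_irr Hlt). Qed.

End PureCycle.

Lemma nth_rot1 (T : Type) (x0 : T) s i : i < size s ->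
  nth x0 (rot 1 s) i = nth x0 s (i.+1 %% size s).
Proof.
case: s => // x s; rewrite rot1_cons nth_rcons /= ltnS => ilt.
case: ltngtP ilt => // [ilt|->] _; first by rewrite modn_small.
by rewrite modnn.
Qed.

Section CyclicBlock.
Variables (V : finType) (m : nat) (ends : 'I_m -> {set V}).
Hypothesis Hcard : forall k, #|ends k| = 2.
Hypothesis Hinj : injective ends.

Lemma cyclic_pairP (s : seq V) x0 k :
  reflect (exists2 i, i < size s &
    ends k = [set nth x0 s (i %% size s); nth x0 s (i.+1 %% size s)])
  (has (fun p => ends k == [set p.1; p.2]) (zip s (rot 1 s))).
Proof.
have sz : size s = size (rot 1 s) by rewrite size_rot.
have szip : size (zip s (rot 1 s)) = size s by rewrite size_zip -sz minnn.
apply: (iffP (has_nthP (x0, x0))) => -[i]; rewrite szip => is_.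
  by rewrite nth_zip //= nth_rot1 // => /eqP ->; exists i; rewrite ?(modn_small is_).
rewrite modn_small // => kE; exists i; rewrite ?szip //.
by rewrite nth_zip //= nth_rot1 // kE.
Qed.

Lemma cycle_edges (s : seq V) x0 (X := fun i => nth x0 s (i %% size s))
    (F := [set k | has (fun p => ends k == [set p.1; p.2]) (zip s (rot 1 s))]) :
    2 < size s -> (forall i, exists k, ends k = [set X i; X i.+1]) ->
  exists eps : nat -> 'I_m, [/\ forall i, eps (i + size s) = eps i,
    forall i, ends (eps i) = [set X i; X i.+1], forall i, eps i \in F &
    forall e, e \in F -> exists i, e = eps i].
Proof.
move=> s3 edge; have [e0 _] := edge 0.
pose eps i := odflt e0 [pick k | ends k == [set X i; X i.+1]].
have Heps i : ends (eps i) = [set X i; X i.+1].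
  rewrite /eps; case: pickP => [k /eqP //|nk]; have [k kE] := edge i.
  by move: (nk k); rewrite kE eqxx.
have X_per i : X (i + size s) = X i by rewrite /X modnDr.
exists eps; split=> //.
- by move=> i; rewrite /eps X_per -addSn X_per.
- move=> i; rewrite inE; apply/(cyclic_pairP s x0); exists (i %% size s); first by rewrite ltn_mod; lia.
  by rewrite modn_mod Heps -(addn1 (i %% size s)) modnDml addn1.
by move=> e; rewrite inE => /(cyclic_pairP s x0)[i _ eE]; exists i; apply: Hinj; rewrite Heps.
Qed.

Lemma pure_cyclic_block_false P M S F (lt : rel 'X_{1..m}) :
    primitive_pair ends P M -> monomial_order lt ->
    (forall d, (d <= P)%MM -> d != P -> standard ends lt d) ->
    (forall d, (d <= M)%MM -> d != M -> standard ends lt d) ->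
    conn_no_cut ends S F -> is_cycle ends S F -> (forall e, e \in F -> 0 < P e) ->
  False.
Proof.
move=> HPM Hlt HP HM [[S0 Sconn] nocut] [s [us s3 SE FE]] FP.
have [x0 x0S] : exists x0, x0 \in S by apply/set0Pn.
set t := size s in s3; pose X i := nth x0 s (i %% t).
have t0 : 0 < t by lia.
have XS i : X i \in S by rewrite SE inE mem_nth // ltn_mod.
have inF k : k \in F -> exists i, ends k = [set X i; X i.+1].
  by rewrite FE inE => /(cyclic_pairP s x0)[i _ kE]; exists i.
have X_eq i j : X i = X j -> i = j %[mod t].
  by move/eqP; rewrite nth_uniq ?ltn_mod // => /eqP.
have X_S i j : X i = X j -> X i.+1 = X j.+1.
  by move/X_eq => ij; rewrite /X -(addn1 i) -(addn1 j) -modnDml ij modnDml.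
have X_P i j : X i.+1 = X j.+1 -> X i = X j.
  move/X_eq/eqP; rewrite -(addn1 i) -(addn1 j) eqn_modDr => /eqP ij.
  by rewrite /X ij.
have X_neq i k : 0 < k < t -> X i != X (i + k).
  move=> kt; apply/eqP => /X_eq/eqP; rewrite -{1}(addn0 i) eqn_modDl mod0n modn_small; lia.
(* [is_cycle] does not demand that consecutive vertices be joined; if the edge between two of
   them were missing, the next vertex would be a cut vertex. *)
have edge i : exists k, ends k = [set X i; X i.+1].
  apply: NNPP => nk; apply: (nocut (X i.+2)); split; first exact: XS.
  have i01 : X i != X i.+1 by rewrite -[i.+1]addn1 X_neq //; lia.
  have i12 : X i.+1 != X i.+2 by rewrite -[i.+2]addn1 X_neq //; lia.
  have i02 : X i != X i.+2 by rewrite -[i.+2]addn2 X_neq //; lia.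
  exists (X i.+1), (X i); split=> //; apply/negP => cn.
  case/eqP: i01; apply: (connect_invariant (Q := fun z => z = X i.+1) _ cn) => // a b.
  case/adjFP => f; rewrite inE => /andP[/inF[j fE] xf] ab aE; case: nk; exists f.
  have := set21 a b; rewrite -ab fE !inE aE => /orP[]/eqP ij.
    by case/negP: xf; rewrite fE (X_S _ _ ij) set22.
  by rewrite -ij (X_P _ _ ij).
have [eps [eps_per Heps epsF Feps]] := cycle_edges s3 edge.
have X_per i : X (i + t) = X i by rewrite /X modnDr.
rewrite -FE in epsF Feps.
apply: (@pure_cycle_false V m ends Hcard P M HPM t X eps F) Hlt HP HM => //.
  by move=> i j it jt /X_eq; rewrite !modn_small.
move=> x i j xi xj; have [xS|xS] := boolP (x \in S).
  apply: contraT => ncn; case: (nocut x); split=> //.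
  by exists (X i), (X j); split.
suff -> : [set k in F | x \notin ends k] = F by apply: Sconn.
apply/setP => k; rewrite inE; apply: andb_idr => /inF[l ->]; apply: contra xS.
by rewrite !inE => /orP[]/eqP->.
Qed.

Lemma universal_mixed (K : fieldType) (es : seq 'I_m) :
    primitive_pair ends (Eplus es) (Eminus es) ->
    in_universal_GB (@toric_ideal V m ends K) (Bw K es) ->
  mixed ends es.
Proof.
move=> HPM [lt [G [Hlt0 HG HBG]]] S F [[_ HS _] Hcyc] Hpure.
have Hlt := term_order_monomial Hlt0.
have [f fG suppf] : exists2 f, f \in G & msupp f =i [:: Eplus es; Eminus es].
  have suppB := msupp_binomialE K (pp_neq HPM).
  case: HBG => fG; [exists (Bw K es) | exists (- Bw K es)%R] => //.
  by move=> u; rewrite (perm_mem (msuppN _)) suppB.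
have suppf' : msupp f =i [:: Eminus es; Eplus es] by move=> u; rewrite suppf !inE orbC.
have HPM' := primitive_pair_sym HPM.
have HP d : (d <= Eplus es)%MM -> d != Eplus es -> standard ends lt d.
  exact: (groebner_proper_divisor_standard Hcard Hlt HG fG (pp_neq HPM) suppf (pp_balanced HPM)).
have HM d : (d <= Eminus es)%MM -> d != Eminus es -> standard ends lt d.
  exact: (groebner_proper_divisor_standard Hcard Hlt HG fG (pp_neq HPM') suppf' (pp_balanced HPM')).
case: Hpure => /subsetP FE.
  by apply: (pure_cyclic_block_false HPM Hlt HP HM HS Hcyc) => e /FE; rewrite in_wplus.
by apply: (pure_cyclic_block_false HPM' Hlt HM HP HS Hcyc) => e /FE; rewrite in_wminus.
Qed.

End CyclicBlock.

(** * Cycles of equally signed edges are blocks *)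

Section CycleBlock.
Variables (V : finType) (m : nat) (ends : 'I_m -> {set V}).
Hypothesis Hcard : forall k, #|ends k| = 2.
Hypothesis Hinj : injective ends.
Variables (P M : 'X_{1..m}).
Hypothesis HPM : primitive_pair ends P M.

Definition msupport (u : 'X_{1..m}) : {set 'I_m} := [set e | 0 < u e].

Lemma cycle_cyclic_block s (W := msupport (P + M)%MM) :
    uniq s -> 2 < size s -> cycle (adjF ends (msupport P)) s ->
  exists S F, cyclic_block ends (\bigcup_(e in W) ends e) W S F /\ F \subset msupport P.
Proof.
move=> us s3 cs; have [x0 _] : exists x0 : V, true by case: s s3 {us cs} => // x; exists x.
set t := size s in s3; pose X i := nth x0 s (i %% t).
have t0 : 0 < t by lia.
have XsP x : x \in s -> exists i, x = X i.
  by move=> xs; exists (index x s); rewrite /X modn_small ?nth_index ?index_mem.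
have sX i : X i \in s by rewrite mem_nth // ltn_mod.
have X_S i : X i.+1 = nth x0 s ((i %% t).+1 %% t).
  by rewrite /X -(addn1 (i %% t)) modnDml addn1.
have adjX i : adjF ends (msupport P) (X i) (X i.+1).
  rewrite X_S -nth_rot1 ?ltn_mod // /X.
  have : i %% t < t by rewrite ltn_mod.
  move: (i %% t) => {}i; move: cs; rewrite /t; case: (s) => [|x p] //= + it; rewrite rot1_cons.
  by move/(pathP x0)/(_ i); rewrite size_rcons => /(_ it); rewrite -rcons_cons nth_rcons /= it.
have edge i : exists k, ends k = [set X i; X i.+1].
  by case/adjFP: (adjX i) => k _ kE; exists k.
have [eps [eps_per Heps epsF Feps]] := cycle_edges Hinj s3 edge.
set F := [set k | _] in epsF Feps.
have FP e : e \in F -> 0 < P e.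
  move=> /Feps[i ->]; case/adjFP: (adjX i) => k; rewrite inE => Pk kE.
  by rewrite (_ : eps i = k) //; apply: Hinj; rewrite Heps.
have X_per i : X (i + t) = X i by rewrite /X modnDr.
have X_inj i j : i < t -> j < t -> X i = X j -> i = j.
  by move=> it jt /eqP; rewrite /X !modn_small // nth_uniq // => /eqP.
have Xneq := X_neq s3 X_per X_inj.
have FW k : k \in F -> 0 < P k + M k by move/FP; lia.
pose S := [set x in s].
have endsF k : k \in F -> ends k \subset S.
  by move/Feps => [i ->]; rewrite Heps; apply/subsetP => x; rewrite !inE => /orP[]/eqP->; apply: sX.
have conn_from x i k : (forall j, j < k -> x \notin ends (eps (i + j))) ->
    connect (adjF ends [set k in F | x \notin ends k]) (X i) (X (i + k)).
  elim: k => [|k IH] H; first by rewrite addn0 connect0.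
  apply: connect_trans (IH _) _ => [j jk|]; first by apply: H; lia.
  by apply/connect1/adjFP; exists (eps (i + k)); [rewrite inE epsF H | rewrite Heps addnS].
have nocut x y z : x \in S -> y \in S -> z \in S -> y != x -> z != x ->
    connect (adjF ends [set k in F | x \notin ends k]) y z.
  rewrite !inE => /XsP[i ->] ys zs yx zx.
  have [cy cz] : connect (adjF ends [set k in F | X i \notin ends k]) (X i.+1) y /\
                 connect (adjF ends [set k in F | X i \notin ends k]) (X i.+1) z; last first.
    by apply: connect_trans cz; rewrite connect_adjF_sym.
  suff H y' : y' \in s -> y' != X i ->
      connect (adjF ends [set k in F | X i \notin ends k]) (X i.+1) y' by split; apply: H.
  move=> {ys zs yx zx} /XsP[j ->] ji.
  have [k [kt ->]] : exists k, k.+1 < t /\ X j = X (i.+1 + k).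
    pose d := (j + t * i.+1 - i.+1) %% t.
    have Xd : X j = X (i.+1 + d).
      by rewrite /X /d modnDmr subnKC ?modnMDl; [rewrite addnC mulnC modnMDl | nia].
    exists d; split=> //; have dt : d < t by rewrite ltn_mod.
    suff : d.+1 != t by lia.
    by apply: contraNneq ji => d1; rewrite Xd addSnnS d1 X_per.
  apply: conn_from => l lk; rewrite Heps !inE addSnnS -addnS.
  by rewrite !(negPf (Xneq _ _ _)) //; lia.
have connF x y : x \in S -> y \in S -> connect (adjF ends F) x y.
  have conn0 i : connect (adjF ends F) (X 0) (X i).
    elim: i => [|i IH]; first exact: connect0.
    apply: connect_trans IH _; apply/connect1/adjFP.
    by exists (eps i); rewrite ?epsF ?Heps.
  rewrite !inE => /XsP[i ->] /XsP[j ->]; apply: connect_trans (conn0 j).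
  by rewrite connect_adjF_sym.
exists S, F; split; last by apply/subsetP => e /FP; rewrite inE.
split; last by exists s.
split.
- split; first (apply/subsetP => x; rewrite inE => /XsP[i ->]); last exact: endsF.
    by apply/bigcupP; exists (eps i); rewrite ?inE ?mnmDE ?FW ?epsF // Heps set21.
  by apply/subsetP => e eF; rewrite inE mnmDE FW.
- split; first split=> //.
    by apply/set0Pn; exists (X 0); rewrite inE.
  move=> x [xS [y [z [yS zS yx zx]]]]; case/negP; exact: nocut.
move=> S' F' [SW FW' endsF'] SS FF [[_ conn'] nocut'].
have F'W k : k \in F' -> 0 < P k + M k.
  by move/(subsetP FW'); rewrite inE mnmDE.
have touch f x : f \in F' -> x \in S -> x \in ends f -> f \in F.
  rewrite inE => fF' /XsP[i ->] xf; apply: contraT => nfF.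
  have b2 := Amap_cycle HPM s3 X_per X_inj Heps epsF FP i.
  have [L [PL ML sepL]] := pp_separation HPM b2.
  have fL : f \notin L.
    apply: ML => //; have := F'W f fF'; rewrite addn_gt0 => /orP[Pf|//].
    by rewrite (P_at_cycle HPM s3 X_per X_inj Heps epsF FP xf) in nfF.
  have [z fE zx] : exists2 z, ends f = [set X i; z] & z != X i.
    have /eqP/cards2P[a [b [ab fE]]] := Hcard f.
    move: xf; rewrite fE !inE => /orP[]/eqP ->; first by exists b; rewrite // eq_sym.
    by exists a; rewrite // setUC.
  have i1 : X i.+1 != X i by rewrite eq_sym -[i.+1]addn1 Xneq // (ltn_trans _ s3).
  have zf : z \in ends f by rewrite fE set22.
  case: (nocut' (X i)); split; first by apply: (subsetP SS); rewrite inE.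
  exists (X i.+1), z; split=> //; first by apply: (subsetP SS); rewrite inE.
    exact: (subsetP (endsF' f fF')).
  apply/negP => /(separates_connect (And3 PL ML sepL) F'W)[|e [We eL ze]].
    exists (eps i); rewrite FW ?epsF // Heps set22; split=> //.
    by apply: PL; rewrite ?Heps ?set21 ?FP.
  by case/eqP: zx; apply: (sepL e f) => //; apply: F'W.
have S'S x : x \in S' -> x \in S.
  move=> xS'; have x0S : X 0 \in S by rewrite inE.
  apply: (connect_invariant (Q := fun x => x \in S) _ (conn' _ _ (subsetP SS _ x0S) xS')) => //.
  move=> a b /adjFP[f fF' fE] aS; apply: (subsetP (endsF f _)); last by rewrite fE set22.
  by apply: (touch f a) => //; rewrite fE set21.
have ES : S' = S by apply/eqP; rewrite eqEsubset SS andbT; apply/subsetP.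
split=> //; apply/eqP; rewrite eqEsubset FF andbT; apply/subsetP => f fF'.
have /eqP/cards2P[a [b [ab fE]]] := Hcard f.
apply: (touch f a) => //; last by rewrite fE set21.
by rewrite -ES (subsetP (endsF' f fF')) // fE set21.
Qed.

End CycleBlock.

Lemma min_degree_cycle (T : finType) (r : rel T) (Q : T -> Prop) x0 :
    irreflexive r -> ssrbool.symmetric r -> Q x0 ->
    (forall x, Q x -> exists y z, [/\ y != z, r x y, r x z, Q y & Q z]) ->
  exists s, [/\ uniq s, 2 < size s & cycle r s].
Proof.
move=> irr sym Q0 H; apply: NNPP => nocyc.
have ext n : exists x p, [/\ size p = n, path r x p, uniq (x :: p) & Q x].
  elim: n => [|n [x [p [sz rp up Qx]]]]; first by exists x0, [::].
  have [y [xy Qy yp]] : exists y, [/\ r x y, Q y & forall w p', p = w :: p' -> y != w].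
    have [y [z [yz xy xz Qy Qz]]] := H x Qx.
    case: p {sz rp up} => [|w p']; first by exists y; split.
    have [yw|yw] := eqVneq y w; last by exists y; split=> // w1 p1 [<- _].
    by exists z; split=> // w1 p1 [<- _]; rewrite -yw eq_sym.
  have [yxp|yxp] := boolP (y \in x :: p); last first.
    by exists y, (x :: p); split=> //=; [rewrite sz | rewrite (sym y x) xy | rewrite yxp].
  case: nocyc; case: p => [|w p] in sz rp up yp yxp *.
    by move: yxp xy; rewrite inE => /eqP->; rewrite irr.
  have yw := yp _ _ erefl.
  have yp' : y \in p.
    move: yxp; rewrite !inE (negPf yw) => /orP[/eqP yx|//].
    by rewrite yx irr in xy.
  move: rp up {sz yp yxp}; case/splitPr: p / yp' => p1 p2 rp up.
  exists [:: x, w & rcons p1 y]; split.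
  - by move: up; rewrite -cat_rcons -!cat_cons cat_uniq => /andP[].
  - by rewrite /= size_rcons.
  move: rp; rewrite -cat_rcons -cat_cons cat_path => /andP[+ _].
  by rewrite /= !rcons_path last_rcons /= (sym y x) xy andbT.
have [x [p [sz _ up _]]] := ext #|T|.
by have := uniq_leq_size up (fun y _ => mem_enum T y); rewrite -cardE /= sz ltnn.
Qed.

(** * A weight isolating a mixed walk in its fiber *)

Section Weight.
Variables (V : finType) (m : nat) (ends : 'I_m -> {set V}).
Hypothesis Hcard : forall k, #|ends k| = 2.
Hypothesis Hinj : injective ends.

Definition in_fiber (P M u : 'X_{1..m}) : Prop :=
  Amap ends u =1 Amap ends P /\ forall e, 0 < u e -> 0 < P e + M e.

Definition degree_on (P u : 'X_{1..m}) x := Amap ends (restrict (msupport P) u) x.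

Lemma degree_on_le P u x : degree_on P u x <= Amap ends u x.
Proof.
by apply: Amap_le; apply/mnm_lepP => e; rewrite mnmE; case: ifP.
Qed.

Lemma degree_on_self P x : degree_on P P x = Amap ends P x.
Proof. by apply: Amap_restrict_all => e _ Pe; rewrite inE. Qed.

Definition anchor (P : 'X_{1..m}) x := #|[set e in msupport P | x \in ends e]| == 1.

Definition component (P : 'X_{1..m}) x : {set 'I_m} :=
  [set e in msupport P | [exists y in ends e, connect (adjF ends (msupport P)) x y]].

(* At an anchor x, a fiber element u is either 0 or P throughout the component of x, and
   this quantity is nonnegative in both cases. *)
Definition anchor_weight (P : 'X_{1..m}) x (u : 'X_{1..m}) : int :=
  ((Amap ends P x)%:Z * (\sum_(e in component P x) u e)%:Z
   - (degree_on P u x)%:Z * (\sum_(e in component P x) P e)%:Z)%R.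

Lemma anchor_weightD P x :
  {morph anchor_weight P x : u v / (u + v)%MM >-> (u + v)%R}.
Proof.
move=> u v; rewrite /anchor_weight.
have -> : degree_on P (u + v)%MM x = degree_on P u x + degree_on P v x.
  rewrite /degree_on -AmapD; congr (Amap ends _ x); apply/mnmP => e.
  by rewrite mnmDE !mnmE; case: ifP.
have -> : \sum_(e in component P x) (u + v)%MM e =
    \sum_(e in component P x) u e + \sum_(e in component P x) v e.
  by rewrite -big_split; apply: eq_bigr => e _; rewrite mnmDE.
by rewrite !PoszD; ring.
Qed.

Definition total_weight (P M u : 'X_{1..m}) : int :=
  (\sum_(x | anchor P x) anchor_weight P x u + \sum_(x | anchor M x) anchor_weight M x u)%R.

Lemma total_weightD P M :
  {morph total_weight P M : u v / (u + v)%MM >-> (u + v)%R}.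
Proof.
move=> u v; rewrite /total_weight.
under eq_bigr do rewrite anchor_weightD.
under [X in (_ + X = _)%R]eq_bigr do rewrite anchor_weightD.
by rewrite !big_split /=; ring.
Qed.

Section Pair.
Variables (P M : 'X_{1..m}).
Hypothesis HPM : primitive_pair ends P M.

Lemma in_fiber_sym u : in_fiber P M u -> in_fiber M P u.
Proof.
by move=> [uP Wu]; split=> [x|e /Wu]; [rewrite uP (pp_balanced HPM) | rewrite addnC].
Qed.

Lemma restrict_split u : in_fiber P M u ->
  u = (restrict (msupport P) u + restrict (msupport M) u)%MM.
Proof.
move=> [_ Wu]; apply/mnmP => e; rewrite mnmDE !mnmE !inE.
have [Pe|P0] := posnP (P e); last by rewrite (pp_disjoint HPM P0) addn0.
have [Me|M0] := posnP (M e); last by [].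
by apply/eqP; rewrite -leqn0 leqNgt; apply/negP => /Wu; rewrite Pe Me.
Qed.

(* Handshake lemma on the side of x cut off by a separation. *)
Lemma degree_on_extremal u x : in_fiber P M u ->
  degree_on P u x = 0 \/ degree_on P u x = Amap ends P x.
Proof.
move=> Hu; have [uP Wu] := Hu.
have := degree_on_le P u x; rewrite uP => le_u.
have := pp_le2 HPM x; rewrite leq_eqVlt => /orP[/eqP b2|]; last by lia.
have [L [PL ML sepL]] := pp_separation HPM b2.
have at_x (v : 'X_{1..m}) : (forall e, 0 < v e -> 0 < P e + M e) ->
    Amap ends (restrict L v) x = degree_on P v x.
  move=> Wv; apply: eq_bigr => e xe; rewrite !mnmE inE.
  have [v0|/Wv] := posnP (v e); first by rewrite v0; do 2!case: ifP.
  rewrite addn_gt0 => /orP[Pe|Me]; first by rewrite PL ?Pe.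
  by rewrite (negPf (ML e xe Me)) (pp_disjoint (primitive_pair_sym HPM) Me).
have off_x y : y != x -> Amap ends (restrict L u) y = Amap ends (restrict L P) y.
  move=> yx; have [/exists_inP[e]|/exists_inPn nL] :=
      boolP [exists e in L, (0 < P e + M e) && (y \in ends e)].
    move=> eL /andP[We ye]; rewrite !Amap_restrict_all ?uP // => f yf.
      move=> Pf; apply: contraNT yx => fL; apply/eqP; apply: (sepL e f) => //.
      by rewrite addn_gt0 Pf.
    by move=> /Wu Wf; apply: contraNT yx => fL; apply/eqP; apply: (sepL e f).
  rewrite !Amap_restrict_none // => f yf.
    by move=> Pf; apply/negP => /nL; rewrite yf addn_gt0 Pf.
  by move=> /Wu Wf; apply/negP => /nL; rewrite yf Wf.
have := sum_Amap (restrict L P) Hcard; have := sum_Amap (restrict L u) Hcard.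
rewrite (bigD1 x) //= at_x // => sum_u.
rewrite (bigD1 x) //= at_x => [|e Pe]; last by rewrite addn_gt0 Pe.
move: sum_u; rewrite (eq_bigr _ off_x) degree_on_self b2.
move: (\sum_(i | _) _) (mdeg _) (mdeg _) le_u => c d1 d2; rewrite b2 -!muln2.
by move: (degree_on P u x) => d; lia.
Qed.

Lemma anchor_gt0 x : anchor P x -> 0 < Amap ends P x.
Proof.
move/cards1P => [e E]; have := set11 e; rewrite -E !inE => /andP[Pe xe].
exact: leq_trans Pe (Amap_ge P xe).
Qed.

Lemma degree_on_cancel u f y : in_fiber P M u -> y \in ends f -> 0 < P f -> u f = P f ->
  forall e, y \in ends e -> 0 < P e -> u e = P e.
Proof.
move=> Hu yf Pf uf e ye Pe; have [-> //|ef] := eqVneq e f.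
have EP : degree_on P u y = Amap ends P y.
  case: (degree_on_extremal y Hu) => // d0.
  have := Amap_ge (restrict (msupport P) u) yf; rewrite mnmE inE Pf uf.
  by rewrite -/(degree_on P u y) d0; lia.
move: EP (pp_le2 HPM y); rewrite /degree_on /Amap.
rewrite (bigD1 f) //= [X in _ = X -> _](bigD1 f) //= [X in X <= 2 -> _](bigD1 f) //=.
rewrite mnmE inE Pf uf => /addnI.
rewrite (bigD1 e) ?ye //= [X in _ = X -> _](bigD1 e) ?ye //= [X in _ + X <= 2 -> _](bigD1 e) ?ye //=.
rewrite mnmE inE Pe => sumE le2.
have rest0 : \sum_(i < m | (y \in ends i) && (i != f) && (i != e)) P i = 0.
  apply/eqP; rewrite -leqn0 -(leq_add2l 2) addn0; apply: leq_trans le2.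
  by rewrite addnA leq_add2r; apply: leq_add Pf Pe.
move: sumE; rewrite rest0 [X in _ + X]big1 ?addn0 // => i Hi.
have /eqP := rest0; rewrite sum_nat_eq0 => /forallP/(_ i); rewrite Hi /= => /eqP P0.
by rewrite mnmE inE P0.
Qed.

Lemma anchor_component u x : in_fiber P M u -> anchor P x ->
  degree_on P u x = Amap ends P x -> forall e, e \in component P x -> u e = P e.
Proof.
move=> Hu /cards1P[e0 E] dx e; rewrite inE => /andP[]; rewrite inE => Pe /exists_inP[y ye xy].
have at_x f : x \in ends f -> 0 < P f -> f = e0.
  by move=> xf Pf; apply/set1P; rewrite -E !inE Pf xf.
have [Pe0 xe0] : 0 < P e0 /\ x \in ends e0.
  by have := set11 e0; rewrite -E !inE => /andP[].
suff H : forall e, y \in ends e -> 0 < P e -> u e = P e by apply: H.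
apply: (connect_invariant (Q := fun y => forall e, y \in ends e -> 0 < P e -> u e = P e) _ xy) => [a b|f xf Pf].
  move=> /adjFP[f]; rewrite inE => Pf fE Ha.
  apply: (degree_on_cancel (f := f)) => //; first by rewrite fE set22.
  by apply: Ha; rewrite ?fE ?set21.
rewrite (at_x f xf Pf); move: dx; rewrite /degree_on /Amap.
rewrite (bigD1 e0) //= [X in _ = X -> _](bigD1 e0) //= mnmE inE Pe0.
rewrite !big1 ?addn0 // => g /andP[xg ge].
  by apply/eqP; rewrite -leqn0 leqNgt; apply: contra ge => /(at_x g xg) ->.
by rewrite mnmE inE; case: ifP => // /(at_x g xg) E'; rewrite E' eqxx in ge.
Qed.

Lemma anchor_weight_ge0 u x : in_fiber P M u -> anchor P x -> (0 <= anchor_weight P x u)%R.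
Proof.
move=> Hu ax; rewrite /anchor_weight; case: (degree_on_extremal x Hu) => d.
  by rewrite d mul0r subr0 -PoszM.
by rewrite d (eq_bigr P) ?subrr // => e /(anchor_component Hu ax d).
Qed.

Lemma anchor_weight_eq0 u x e : in_fiber P M u -> anchor P x ->
  anchor_weight P x u = 0%R -> e \in component P x -> u e <= P e.
Proof.
move=> Hu ax; rewrite /anchor_weight; case: (degree_on_extremal x Hu) => d; last first.
  by move=> _ /(anchor_component Hu ax d) ->.
rewrite d mul0r subr0 => /eqP; rewrite -PoszM eqz_nat muln_eq0.
rewrite (gtn_eqF (anchor_gt0 ax)) /= sum_nat_eq0 => /forallP/(_ e)/implyP H /H /eqP ->.
by [].
Qed.

Lemma anchor_weight_self : anchor_weight P ^~ P =1 fun=> 0%R.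
Proof. by move=> x; rewrite /anchor_weight degree_on_self subrr. Qed.

Lemma anchor_weight_other : anchor_weight P ^~ M =1 fun=> 0%R.
Proof.
move=> x; rewrite /anchor_weight big1 => [|e]; last by rewrite !inE => /andP[/(pp_disjoint HPM)].
rewrite /degree_on Amap_restrict_none ?mul0r ?mulr0 // => e _ Me.
by rewrite inE (pp_disjoint (primitive_pair_sym HPM) Me).
Qed.

(* A component without anchor has minimum degree at least two, hence contains a cycle. *)
Lemma anchor_exists e :
    (forall s, uniq s -> 2 < size s -> cycle (adjF ends (msupport P)) s -> False) ->
  0 < P e -> exists2 x, anchor P x & e \in component P x.
Proof.
move=> nocyc Pe; apply: NNPP => noanchor.
have [y0 y0e] : exists y, y \in ends e by apply/card_gt0P; rewrite Hcard.
pose r := adjF ends (msupport P).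
have rsym : ssrbool.symmetric r by apply: adjF_sym.
pose Q z := connect r y0 z /\ exists2 f, 0 < P f & z \in ends f.
have rirr : irreflexive r.
  move=> x; apply/adjFP => -[k _ kE]; have := Hcard k.
  by rewrite kE setUid cards1.
have Q0 : Q y0 by split; [exact: connect0 | exists e].
have [x [yx [f Pf xf]]|s [us s3 cs]] := min_degree_cycle rirr rsym Q0; last exact: nocyc s3 cs.
have : ~~ anchor P x.
  apply/negP => ax; case: noanchor; exists x => //; rewrite !inE Pe /=.
  by apply/exists_inP; exists y0 => //; rewrite connect_adjF_sym.
rewrite /anchor eqn_leq negb_and -ltnNge -leqNgt leqn0 orbC cards_eq0 => /orP[/eqP/setP/(_ f)|].
  by rewrite !inE Pf xf.
case/card_gt1P => g [h []]; rewrite !inE => /andP[Pg xg] /andP[Ph xh] gh.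
have other k : x \in ends k -> exists z, ends k = [set x; z].
  move=> xk; have /eqP/cards2P[a [b [_ kE]]] := Hcard k.
  by move: xk; rewrite kE !inE => /orP[]/eqP ->; [exists b | exists a; rewrite setUC].
have [y gE] := other g xg; have [z hE] := other h xh.
have [rxy rxz] : r x y /\ r x z.
  by split; apply/adjFP; [exists g | exists h]; rewrite ?inE.
exists y, z; split=> //.
- by apply: contraNneq gh => yz; apply/eqP/Hinj; rewrite gE hE yz.
- split; first exact: connect_trans yx (connect1 rxy).
  by exists g; rewrite // gE set22.
split; first exact: connect_trans yx (connect1 rxz).
by exists h; rewrite // hE set22.
Qed.

End Pair.

Variables (P M : 'X_{1..m}).
Hypothesis HPM : primitive_pair ends P M.
Let HMP := primitive_pair_sym HPM.
Hypothesis noPcycle :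
  forall s, uniq s -> 2 < size s -> cycle (adjF ends (msupport P)) s -> False.
Hypothesis noMcycle :
  forall s, uniq s -> 2 < size s -> cycle (adjF ends (msupport M)) s -> False.

Lemma total_weight_P : total_weight P M P = 0%R.
Proof.
rewrite /total_weight !big1 ?addr0 // => x _; first exact: (anchor_weight_other HMP).
exact: anchor_weight_self.
Qed.

Lemma total_weight_M : total_weight P M M = 0%R.
Proof.
rewrite /total_weight !big1 ?addr0 // => x _; first exact: anchor_weight_self.
exact: (anchor_weight_other HPM).
Qed.

Lemma fiber_bounded u : in_fiber P M u ->
  (forall e, 0 < P e -> u e <= P e) -> (forall e, 0 < M e -> u e <= M e) -> u = P \/ u = M.
Proof.
move=> Hu uP uM; have splitu := restrict_split HPM Hu.
set p := restrict (msupport P) u in splitu; set q := restrict (msupport M) u in splitu.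
have pP : (p <= P)%MM by apply/mnm_lepP => e; rewrite mnmE inE; case: ifP => // /uP.
have qM : (q <= M)%MM by apply/mnm_lepP => e; rewrite mnmE inE; case: ifP => // /uM.
have [|E|[E1 E2]] := pp_minimal HPM pP (lem_subr M q).
- by move=> x; rewrite AmapB // -(pp_balanced HPM) -(proj1 Hu) [in X in X - _]splitu AmapD addnK.
- have p0 : p = 0%MM.
    apply/mnmP => e; rewrite mnm0E; apply/eqP; rewrite -leqn0 leqNgt; apply/negP => pe.
    have Pe : 0 < P e := leq_trans pe (mnm_lepP pP e).
    by move: pe; rewrite E mnmBE (pp_disjoint HPM Pe).
  right; rewrite splitu p0 add0m -[RHS](submK qM) -E p0 add0m.
  by [].
left; rewrite splitu E1 (_ : q = 0%MM) ?addm0 //.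
by apply: (@addmI _ M); rewrite addm0 -{1}E2 submK.
Qed.

Lemma total_weight_gt0 u : in_fiber P M u -> u != P -> u != M -> (0 < total_weight P M u)%R.
Proof.
move=> Hu uP uM; have Hu' := in_fiber_sym HPM Hu.
have geP x : anchor P x -> (0 <= anchor_weight P x u)%R by exact: (anchor_weight_ge0 HPM).
have geM x : anchor M x -> (0 <= anchor_weight M x u)%R by exact: (anchor_weight_ge0 HMP).
have sP : (0 <= \sum_(x | anchor P x) anchor_weight P x u)%R by apply: sumr_ge0.
have sM : (0 <= \sum_(x | anchor M x) anchor_weight M x u)%R by apply: sumr_ge0.
rewrite lt_def addr_ge0 // andbT; apply/negP; rewrite paddr_eq0 // => /andP[].
rewrite !psumr_eq0 // => /allP P0 /allP M0.
have [||E|E] := fiber_bounded Hu.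
- move=> e /(anchor_exists noPcycle)[x ax ex]; apply: (anchor_weight_eq0 HPM Hu ax _ ex).
  by apply/eqP; apply: (implyP (P0 x _)); rewrite ?mem_index_enum.
- move=> e /(anchor_exists noMcycle)[x ax ex]; apply: (anchor_weight_eq0 HMP Hu' ax _ ex).
  by apply/eqP; apply: (implyP (M0 x _)); rewrite ?mem_index_enum.
- by rewrite E eqxx in uP.
by rewrite E eqxx in uM.
Qed.

Definition outside_degree (u : 'X_{1..m}) : int := (\sum_(e | P e + M e == 0) u e)%N.

Lemma outside_degreeD : {morph outside_degree : u v / (u + v)%MM >-> (u + v)%R}.
Proof.
move=> u v; rewrite /outside_degree -PoszD -big_split; congr Posz.
by apply: eq_bigr => e _; rewrite mnmDE.
Qed.

Definition walk_order : rel 'X_{1..m} :=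
  refine_by (@mdegz m) (refine_by outside_degree
    (refine_by (total_weight P M) (fun u v => (u < v)%O))).

Lemma walk_order_term_order : term_order walk_order.
Proof.
apply: refine_mdeg_term_order; apply: (refine_by_order outside_degreeD).
exact: (refine_by_order (@total_weightD P M) (@mnmc_order m)).
Qed.

Lemma walk_order_lt c : Amap ends c =1 Amap ends P -> c != P -> c != M ->
  walk_order P c /\ walk_order M c.
Proof.
move=> cP neP neM.
have degP : mdegz P = mdegz c by rewrite /mdegz (eq_Amap_mdeg Hcard cP).
have degM : mdegz M = mdegz P.
  by rewrite /mdegz (eq_Amap_mdeg Hcard (pp_balanced HPM)).
have out0 (v : 'X_{1..m}) : (forall e, v e <= P e + M e) -> outside_degree v = 0%R.
  move=> H; rewrite /outside_degree big1 // => e /eqP E.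
  by apply/eqP; rewrite -leqn0 -E.
have outP : outside_degree P = 0%R by apply: out0 => e; apply: leq_addr.
have outM : outside_degree M = 0%R by apply: out0 => e; apply: leq_addl.
rewrite /walk_order /refine_by degM -degP ltxx eqxx outP outM /=.
rewrite total_weight_P total_weight_M.
have [outc|] := eqVneq 0%R (outside_degree c); last first.
  rewrite /outside_degree; move: (\sum_(_ | _) _)%N => k.
  by rewrite ltz_nat lt0n eq_sym => /negPf; rewrite -eqz_nat => ->.
have Hc : in_fiber P M c.
  split=> // e ce; rewrite lt0n; apply: contraTneq ce => E.
  move/esym/eqP: outc; rewrite /outside_degree eqz_nat sum_nat_eq0 => /forallP/(_ e).
  by rewrite E eqxx /= => /eqP ->.
by rewrite -outc ltxx (total_weight_gt0 Hc neP neM).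
Qed.

End Weight.

Section Isolated.
Variables (K : fieldType) (V : finType) (m : nat) (ends : 'I_m -> {set V}).
Hypothesis Hcard : forall k, #|ends k| = 2.

Lemma isolated_in_groebner (lt : rel 'X_{1..m}) P M :
    monomial_order lt -> primitive_pair ends P M ->
    (forall c, Amap ends c =1 Amap ends P -> c != P -> c != M -> lt P c /\ lt M c) ->
    lt M P ->
  exists2 G, reduced_groebner (@toric_ideal V m ends K) lt G & ('X_[P] - 'X_[M])%R \in G.
Proof.
move=> Hlt HPM Hc MP; apply: binomial_mem_groebner => //; last exact: (pp_balanced HPM).
  apply/andP; split.
    by apply/(nonstandardP Hcard); exists M => // x; rewrite (pp_balanced HPM).
  apply/forallP => i; apply/implyP => Pi; apply/(standardP Hcard) => c cP; apply/negP => lc.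
  have iP : (U_(i) <= P)%MM by apply/mnm_lepP => j; rewrite mnm1E; case: eqP => // <-.
  have fib : Amap ends (c + U_(i))%MM =1 Amap ends P.
    by move=> x; rewrite AmapD cP -AmapD submK.
  have ltP : lt (c + U_(i))%MM P by rewrite -[X in lt _ X](submK iP) (mlt_add2r Hlt).
  have neP : (c + U_(i))%MM != P by apply: contraTneq ltP => ->; rewrite (mlt_irr Hlt).
  have [E|neM] := eqVneq (c + U_(i))%MM M.
    have /mnmP/(_ i) := E; rewrite mnmDE mnm1E eqxx (pp_disjoint HPM Pi); lia.
  by have [/(mlt_asym Hlt)] := Hc _ fib neP neM; rewrite ltP.
apply/(standardP Hcard) => c cM; have cP x : Amap ends c x = Amap ends P x by rewrite cM (pp_balanced HPM).
have [->|neM] := eqVneq c M; first by rewrite (mlt_irr Hlt).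
have [->|neP] := eqVneq c P; first by rewrite (mlt_asym Hlt MP).
by have [_ /(mlt_asym Hlt) ->] := Hc c cP neP neM.
Qed.

Hypothesis Hinj : injective ends.

Lemma mixed_universal (es : seq 'I_m) :
    primitive_pair ends (Eplus es) (Eminus es) -> mixed ends es ->
  in_universal_GB (@toric_ideal V m ends K) (Bw K es).
Proof.
move=> HPM Hmix; have HMP := primitive_pair_sym HPM.
have wE : wedges es = msupport (Eplus es + Eminus es)%MM.
  by apply/setP => e; rewrite in_wedges inE mnmDE.
have noP s : uniq s -> 2 < size s -> cycle (adjF ends (msupport (Eplus es))) s -> False.
  move=> us s3 cs; have [S [F [SF FP]]] := cycle_cyclic_block Hcard Hinj HPM us s3 cs.
  apply: (Hmix S F); first by rewrite /wverts wE.
  by left; apply: subset_trans FP _; apply/subsetP => e; rewrite inE in_wplus.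
have noM s : uniq s -> 2 < size s -> cycle (adjF ends (msupport (Eminus es))) s -> False.
  move=> us s3 cs; have [S [F [SF FM]]] := cycle_cyclic_block Hcard Hinj HMP us s3 cs.
  apply: (Hmix S F); first by rewrite /wverts wE addmC.
  by right; apply: subset_trans FM _; apply/subsetP => e; rewrite inE in_wminus.
have Hterm := walk_order_term_order ends (Eplus es) (Eminus es).
have Hlt := term_order_monomial Hterm.
have Hc := walk_order_lt Hcard Hinj HPM noP noM.
case/orP: (mlt_total Hlt (pp_neq HPM)) => [PM|MP].
  have [c cM cneM cneP|G HG BG] := isolated_in_groebner Hlt HMP _ PM.
    have cP x : Amap ends c x = Amap ends (Eplus es) x by rewrite cM (pp_balanced HPM).
    by case: (Hc c cP cneP cneM).
  exists (walk_order ends (Eplus es) (Eminus es)), G; split=> //.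
  by right; rewrite /Bw opprB.
have [G HG BG] := isolated_in_groebner Hlt HPM Hc MP.
by exists (walk_order ends (Eplus es) (Eminus es)), G; split=> //; left.
Qed.

End Isolated.

Theorem theorem3p4 (K : fieldType) (V : finType) (m : nat)
    (ends : 'I_m -> {set V})
    (Hsimple : simple_graph ends) (Hconn : connected_graph ends)
    (es : seq 'I_m) (vs : seq V)
    (Hw : even_closed_walk ends es vs) (Hprim : primitive ends K es) :
  in_universal_GB (@toric_ideal V m ends K) (Bw K es) <-> mixed ends es.
Proof.
have [Hcard Hinj] := Hsimple.
have HPM := primitive_walk_pair Hcard Hw Hprim.
split; first exact: universal_mixed.
exact: mixed_universal.
Qed.
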